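(* (1) Let $a,b\in\mathbb{C}$. Any finite nontrivial irreducible conformal $TSV(a,b)$-module is free of rank one over $\mathbb{C}[\partial]$. If $a\neq1$ or $b\neq0$, it is isomorphic to $M_{\alpha,\beta}$ for some $\alpha,\beta\in\mathbb{C}$ with $\alpha\neq0$; if $a=1$ and $b=0$, it is isomorphic to $M_{\alpha,\beta,\gamma}$ for some $\alpha,\beta,\gamma\in\mathbb{C}$ with $\alpha\neq0$ or $\gamma\neq0$. (2) Let $c\in\mathbb{C}$. Any finite nontrivial irreducible conformal $TSV(c)$-module is free of rank one over $\mathbb{C}[\partial]$ and is isomorphic to the $TSV(c)$-module $M_{\alpha,\beta}$ for some $\alpha,\beta\in\mathbb{C}$ with $\alpha\neq0$.
   Context: All vector spaces are over $\mathbb{C}$. A Lie conformal algebra $\mathcal{R}$ is a $\mathbb{C}[\partial]$-module with a $\mathbb{C}$-linear map $\mathcal{R}\otimes\mathcal{R}\to\mathbb{C}[\lambda]\otimes\mathcal{R}$, $x\otimes y\mapsto[x_\lambda y]$, such that $[\partial x_\lambda y]=-\lambda[x_\lambda y]$, $[x_\lambda\partial y]=(\partial+\lambda)[x_\lambda y]$, $[x_\lambda y]=-[y_{-\lambda-\partial}x]$ and $[x_\lambda[y_\mu z]]=[[x_\lambda y]_{\lambda+\mu}z]+[y_\mu[x_\lambda z]]$. A conformal module $V$ over $\mathcal{R}$ is a $\mathbb{C}[\partial]$-module with a $\mathbb{C}$-linear map $\mathcal{R}\otimes V\to\mathbb{C}[\lambda]\otimes V$, $x\otimes v\mapsto x_\lambda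 v$, such that $(\partial x)_\lambda v=-\lambda x_\lambda v$, $x_\lambda(\partial v)=(\partial+\lambda)x_\lambda v$ and $x_\lambda(y_\mu v)-y_\mu(x_\lambda v)=[x_\lambda y]_{\lambda+\mu}v$. It is finite if finitely generated over $\mathbb{C}[\partial]$; its rank is its rank as a $\mathbb{C}[\partial]$-module; it is trivial if $x_\lambda v=0$ for all $x\in\mathcal{R}$, $v\in V$; it is irreducible if it is nonzero and has no conformal submodules other than $0$ and itself. For $a,b\in\mathbb{C}$, $TSV(a,b)$ is the Lie conformal algebra which is a free $\mathbb{C}[\partial]$-module with basis $L,Y,M$ and $$[L_\lambda L]=(\partial+2\lambda)L,\quad [L_\lambda Y]=(\partial+a\lambda+b)Y,\quad [L_\lambda M]=(\partial+2(a-1)\lambda+2b)M,$$ $$[Y_\lambda Y]=(\partial+2\lambda)M,\quad [Y_\lambda M]=[M_\lambda M]=0.$$ For $c\in\mathbb{C}$, $TSV(c)$ is the Lie conformal algebra which is a free $\mathbb{C}[\partial]$-module with basis $L,Y,M$ and $$[L_\lambda L]=(\partial+2\lambda)L,\quad [L_\lambda Y]=(\partial+\tfrac32\lambda+c)Y,\quad [L_\lambda M]=(\partial+2c)M,$$ $$[Y_\lambda Y]=(\partial+2\lambda)(-\partial-2c)M,\quad [Y_\lambda M]=[M_\lambda M]=0.$$ For $\alpha,\beta\in\mathbb{C}$, both over $TSV(a,b)$ with $a\neq1$ or $b\neq0$ and over $TSV(c)$, $M_{\alpha,\beta}=\mathbb{C}[\partial]v$ denotes the module free of rank one over $\mathbb{C}[\partial]$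 with $L_\lambda v=(\partial+\alpha\lambda+\beta)v$, $Y_\lambda v=M_\lambda v=0$. For $\alpha,\beta,\gamma\in\mathbb{C}$, $M_{\alpha,\beta,\gamma}=\mathbb{C}[\partial]v$ denotes the $TSV(1,0)$-module free of rank one over $\mathbb{C}[\partial]$ with $L_\lambda v=(\partial+\alpha\lambda+\beta)v$, $Y_\lambda v=\gamma v$, $M_\lambda v=0$. *)

(* Defs.v *)
From HB Require Import structures.
From mathcomp Require Import all_boot all_order all_algebra.
From mathcomp Require Import finmap.
From mathcomp Require Import ring.

Set Implicit Arguments.
Unset Strict Implicit.
Unset Printing Implicit Defensive.

Import GRing.Theory Num.Theory.
Local Open Scope ring_scope.

(* A K[∂]-module is an lmodType {poly K}: ∂ acts as 'X, and the scalar c : K  *)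
(* acts as c%:P.  An element \sum_n λ^n v_n of K[λ] ⊗ V is the finitely       *)
(* supported family n |-> v_n.                                                *)
Definition lpoly (K : fieldType) (V : lmodType {poly K}) :=
  {fsfun nat -> V with 0}.

Section LieConformal.
Variable K : fieldType.

(* n-th coefficient of λ * p *)
Definition lambda_mul (V : zmodType) (p : nat -> V) (n : nat) : V :=
  if n is n'.+1 then p n' else 0.

Record sesquilinear (A V : lmodType {poly K}) (act : A -> V -> lpoly V) := {
  sesqPl : forall (c : K) x x' v n,
    act (c%:P *: x + x') v n = c%:P *: act x v n + act x' v n;
  sesqPr : forall (c : K) x v v' n,
    act x (c%:P *: v + v') n = c%:P *: act x v n + act x v' n;
  sesqXl : forall x v n, act ('X *: x) v n = - lambda_mul (act x v) n;
  sesqXr : forall x v n,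
    act x ('X *: v) n = 'X *: act x v n + lambda_mul (act x v) n }.

(* Coefficient of λ^m μ^n in                                                  *)
(*   x_λ (y_μ v) - y_μ (x_λ v) = [x_λ y]_{λ+μ} v,                             *)
(* which for act = br is the Jacobi identity of a Lie conformal algebra;      *)
(* the right-hand side is \sum_(i, k) λ^i (λ + μ)^k act (br x y i) v k.       *)
Definition lambda_jacobi (A V : lmodType {poly K})
    (br : A -> A -> lpoly A) (act : A -> V -> lpoly V) :=
  forall x y v (m n : nat),
    act x (act y v n) m - act y (act x v m) n =
    \sum_(i < m.+1) act (br x y i) v (m - i + n)%N *+ 'C(m - i + n, n).

(* Coefficient of λ^n in [x_λ y] = - [y_{-λ-∂} x]: inside {poly {poly K}},    *)
(* 'X is λ and 'X%:P is ∂.                                                    *)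
Definition lambda_skew (A : lmodType {poly K}) (br : A -> A -> lpoly A) :=
  forall x y n,
    br x y n =
    - \sum_(k <- finsupp (br y x)) ((- 'X - 'X%:P) ^+ k)`_n *: br y x k.

Record lieConformalAlgebra := LieConformalAlgebra {
  lca_sort :> lmodType {poly K};
  lca_bracket : lca_sort -> lca_sort -> lpoly lca_sort;
  lca_sesquilinear : sesquilinear lca_bracket;
  lca_skew : lambda_skew lca_bracket;
  lca_jacobi : lambda_jacobi lca_bracket lca_bracket }.

Record conformalModule (A : lieConformalAlgebra) := ConformalModule {
  cm_sort :> lmodType {poly K};
  cm_act : A -> cm_sort -> lpoly cm_sort;
  cm_sesquilinear : sesquilinear cm_act;
  cm_jacobi : lambda_jacobi (@lca_bracket A) cm_act }.

End LieConformal.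

Section Modules.
Variables (K : fieldType) (A : lieConformalAlgebra K).
Implicit Types V W : conformalModule A.

Definition cm_finite V :=
  exists (n : nat) (e : 'I_n -> V),
    forall v : V, exists c : 'I_n -> {poly K}, v = \sum_(i < n) c i *: e i.

Definition cm_trivial V := forall (x : A) (v : V) n, cm_act x v n = 0.

Record cm_submodule V (U : V -> Prop) : Prop := {
  cm_sub0 : U 0;
  cm_subP : forall (p : {poly K}) u w, U u -> U w -> U (p *: u + w);
  cm_sub_act : forall (x : A) u n, U u -> U (cm_act x u n) }.

Definition cm_irreducible V :=
  (exists v : V, v <> 0) /\
  forall U : V -> Prop, cm_submodule U ->
    (forall v, U v -> v = 0) \/ (forall v, U v).

Definition cm_free_rank1 V :=
  exists v : V, forall w : V, exists! p : {poly K}, w = p *: v.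

Definition cm_iso V W :=
  exists f : {linear V -> W},
    bijective f /\ forall (x : A) (v : V) n, f (cm_act x v n) = cm_act x (f v) n.

End Modules.

Section RowEntries.
Variables (S : pzRingType) (n : nat).
Implicit Types u v : 'rV[S]_n.

Lemma rowDE u v j : (u + v) 0 j = u 0 j + v 0 j. Proof. by rewrite mxE. Qed.
Lemma rowNE u j : (- u) 0 j = - u 0 j. Proof. by rewrite mxE. Qed.
Lemma rowZE a u j : (a *: u) 0 j = a * u 0 j. Proof. by rewrite mxE. Qed.
Lemma row0E j : (0 : 'rV[S]_n) 0 j = 0. Proof. by rewrite mxE. Qed.

End RowEntries.

(* Free modules.  In {poly {poly K}}, 'X is λ and 'X%:P is ∂; thus            *)
(* x^:P \Po (- 'X) is x(-λ) and poly_XaY v is v(∂ + λ).                       *)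
Section FreeAction.
Variables (K : fieldType) (n m : nat).
Variable P : 'I_n -> 'I_m -> 'rV[{poly {poly K}}]_m.

Fact free_act_key : unit. Proof. exact: tt. Qed.

Definition free_act_poly (x : 'rV[{poly K}]_n) (v : 'rV[{poly K}]_m) :
    'rV[{poly {poly K}}]_m :=
  locked_with free_act_key (\sum_i \sum_j
    ((map_poly polyC (x 0 i) \Po (- 'X)) * poly_XaY (v 0 j)) *: P i j).

Definition row_size (q : 'rV[{poly {poly K}}]_m) : nat :=
  \max_j size (q 0%R j).

Lemma leq_row_size (q : 'rV[{poly {poly K}}]_m) j : (size (q 0%R j) <= row_size q)%N.
Proof. exact: (leq_bigmax (F := fun j => size (q 0%R j)) j). Qed.

Definition lpoly_of_row (q : 'rV[{poly {poly K}}]_m) : lpoly 'rV[{poly K}]_m :=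
  [fsfun k in
    seq_fset tt (iota 0 (row_size q)) =>
    \row_j (q 0 j)`_k].

Lemma free_act_polyUnlock x v : free_act_poly x v = \sum_i \sum_j
  ((map_poly polyC (x 0 i) \Po (- 'X)) * poly_XaY (v 0 j)) *: P i j.
Proof. exact: locked_withE. Qed.

(* sesquilinear extension of (e_i)_λ e_j = P i j *)
Definition free_act x v : lpoly 'rV[{poly K}]_m :=
  locked_with free_act_key (lpoly_of_row (free_act_poly x v)).

Lemma lpoly_of_rowE q k : lpoly_of_row q k = \row_j (q 0 j)`_k.
Proof.
rewrite /lpoly_of_row fsfunE seq_fsetE mem_iota /= add0n.
case: ltnP => // le_k; apply/rowP=> j; rewrite !mxE nth_default //.
exact: leq_trans (leq_row_size q j) le_k.
Qed.

Lemma free_actE x v k j : free_act x v k 0 j = (free_act_poly x v 0 j)`_k.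
Proof. by rewrite /free_act locked_withE lpoly_of_rowE mxE. Qed.

Lemma free_act_eq0 x v N k :
  (forall j, (size (free_act_poly x v 0%R j) <= N)%N) -> (N <= k)%N ->
  free_act x v k = 0.
Proof.
move=> leN lek; apply/rowP => j; rewrite [LHS]free_actE [RHS]row0E.
exact/nth_default/leq_trans/lek/leN.
Qed.

Lemma free_act_polyE x v t :
  free_act_poly x v 0 t =
  \sum_i \sum_j ((map_poly polyC (x 0 i) \Po (- 'X)) * poly_XaY (v 0 j)) * P i j 0 t.
Proof.
by rewrite free_act_polyUnlock summxE; apply: eq_bigr => i _; rewrite summxE; apply: eq_bigr => j _; rewrite mxE.
Qed.

Lemma free_act_poly_basis i j :
  free_act_poly (delta_mx 0 i) (delta_mx 0 j) = P i j.
Proof.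
rewrite free_act_polyUnlock (bigD1 i) //= (bigD1 j) //= !mxE !eqxx /poly_XaY.
rewrite rmorph1 -polyC1 !comp_polyC mulr1 scale1r big1 ?addr0 => [|j' /negPf ne].
  rewrite big1 ?addr0 // => i' /negPf ne; rewrite big1 // => j' _.
  by rewrite !mxE ne rmorph0 comp_poly0 mul0r scale0r.
by rewrite !mxE ne rmorph0 comp_poly0 mulr0 scale0r.
Qed.

Lemma free_act_polyPl c x x' v :
  free_act_poly (c%:P *: x + x') v =
  c%:P%:P *: free_act_poly x v + free_act_poly x' v.
Proof.
rewrite !free_act_polyUnlock scaler_sumr -big_split; apply: eq_bigr => i _ /=.
rewrite scaler_sumr -big_split; apply: eq_bigr => j _ /=.
rewrite !mxE rmorphD rmorphM /= map_polyC comp_polyD comp_polyM comp_polyC.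
by rewrite scalerA -scalerDl; congr (_ *: _); ring.
Qed.

Lemma free_act_polyPr c x v v' :
  free_act_poly x (c%:P *: v + v') =
  c%:P%:P *: free_act_poly x v + free_act_poly x v'.
Proof.
rewrite !free_act_polyUnlock scaler_sumr -big_split; apply: eq_bigr => i _ /=.
rewrite scaler_sumr -big_split; apply: eq_bigr => j _ /=.
rewrite !mxE /poly_XaY rmorphD rmorphM /= map_polyC comp_polyD comp_polyM comp_polyC.
by rewrite scalerA -scalerDl; congr (_ *: _); ring.
Qed.

Lemma free_act_polyXl x v :
  free_act_poly ('X *: x) v = - ('X *: free_act_poly x v).
Proof.
rewrite !free_act_polyUnlock scaler_sumr -sumrN; apply: eq_bigr => i _ /=.
rewrite scaler_sumr -sumrN; apply: eq_bigr => j _ /=.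
rewrite !mxE rmorphM /= map_polyX comp_polyM comp_polyX.
by rewrite scalerA -scaleNr; congr (_ *: _); ring.
Qed.

Lemma free_act_polyXr x v :
  free_act_poly x ('X *: v) =
  'X%:P *: free_act_poly x v + 'X *: free_act_poly x v.
Proof.
rewrite !free_act_polyUnlock -scalerDl scaler_sumr; apply: eq_bigr => i _ /=.
rewrite scaler_sumr; apply: eq_bigr => j _ /=.
rewrite !mxE /poly_XaY rmorphM /= map_polyX comp_polyM comp_polyX.
by rewrite scalerA; congr (_ *: _); ring.
Qed.

Lemma free_act_sesquilinear : sesquilinear free_act.
Proof.
split.
- move=> c x x' v k; apply/rowP => j.
  rewrite [RHS]rowDE [X in _ = X + _]rowZE [LHS]free_actE.
  rewrite [X in _ = _ + X]free_actE [X in _ = _ * X + _]free_actE.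
  by rewrite free_act_polyPl rowDE rowZE coefD coefCM.
- move=> c x v v' k; apply/rowP => j.
  rewrite [RHS]rowDE [X in _ = X + _]rowZE [LHS]free_actE.
  rewrite [X in _ = _ + X]free_actE [X in _ = _ * X + _]free_actE.
  by rewrite free_act_polyPr rowDE rowZE coefD coefCM.
- move=> x v k; apply/rowP => j.
  rewrite [RHS]rowNE [LHS]free_actE free_act_polyXl [X in polyseq X]rowNE.
  rewrite [X in polyseq (- X)]rowZE coefN coefXM; congr (- _).
  by case: k => [|k]; [rewrite [RHS]row0E | rewrite [RHS]free_actE].
- move=> x v k; apply/rowP => j.
  rewrite [RHS]rowDE [X in _ = X + _]rowZE [LHS]free_actE free_act_polyXr.
  rewrite [X in polyseq X]rowDE [X in polyseq (X + _)]rowZE [X in polyseq (_ + X)]rowZE.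
  rewrite coefD coefCM coefXM [X in _ = _ * X + _]free_actE; congr (_ + _).
  by case: k => [|k]; [rewrite [RHS]row0E | rewrite [RHS]free_actE].
Qed.

End FreeAction.

Lemma coef_poly_XaY (R : comNzRingType) (q : {poly R}) n k :
  (poly_XaY q)`_n`_k = q`_(k + n) *+ 'C(k + n, n).
Proof.
elim/poly_ind: q n k => [|q c IHq] n k.
  by rewrite poly_XaY0 !coef0 mul0rn.
have -> : poly_XaY (q * 'X + c%:P) =
    poly_XaY q * 'X + poly_XaY q * 'X%:P + c%:P%:P.
  rewrite /poly_XaY rmorphD rmorphM /= map_polyX map_polyC comp_polyD comp_polyM.
  by rewrite comp_polyX comp_polyC mulrDr.
rewrite !coefD !(coefMX, coefMC, coefC).
case: n k => [|n] [|k] //=; rewrite ?IHq ?coef0 ?coefC ?addr0 ?add0r ?addn0 ?add0n ?bin0 ?binn //=.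
by rewrite [in RHS]addSn binS mulrnDr addrC addSnnS.
Qed.

Lemma poly_vanish (F : numFieldType) (S : idomainType) (f : F -> S)
    (p : {poly S}) : injective f -> (forall u, p.[f u] = 0) -> p = 0.
Proof.
move=> f_inj p0; apply/eqP/negP => /negP p_neq0.
have := max_poly_roots (rs := [seq f i%:R | i <- iota 0 (size p)]) p_neq0.
rewrite size_map size_iota ltnn; suff [-> ->] : all (root p) [seq f i%:R | i <- iota 0 (size p)]
  /\ uniq [seq f i%:R | i <- iota 0 (size p)] by move=> /(_ isT isT).
split; first by apply/allP => _ /mapP[i _ ->]; rewrite rootE p0.
rewrite map_inj_uniq ?iota_uniq // => i j /f_inj /eqP.
by rewrite eqr_nat => /eqP.
Qed.

Lemma poly2_ext (F : numFieldType) (p q : {poly {poly {poly F}}}) :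
  (forall u l : F, p.[u%:P%:P].[l%:P] = q.[u%:P%:P].[l%:P]) -> p = q.
Proof.
move=> pq; apply/eqP; rewrite -subr_eq0; apply/eqP.
apply: (poly_vanish (f := fun u : F => u%:P%:P)) => [u v /polyC_inj/polyC_inj //|u].
apply: (poly_vanish (f := fun l : F => l%:P)) => [u' v /polyC_inj //|l].
by rewrite !hornerE pq subrr.
Qed.

(* The skew-symmetry and Jacobi identities on basis vectors, the latter with  *)
(* λ, μ specialized to arbitrary l, u : K (K is infinite in all uses).        *)
Section BasisIdentities.
Variables (K : fieldType) (n : nat) (P : 'I_n -> 'I_n -> 'rV[{poly {poly K}}]_n).

Definition skew_on_basis :=
  forall i j t, P i j 0 t = - (P j i 0 t \Po (- 'X - 'X%:P)).

Definition jacobi_on_basis m (Q : 'I_n -> 'I_m -> 'rV[{poly {poly K}}]_m) :=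
  forall (l u : K) i j k t,
    \sum_s ((Q j k 0 s).[u%:P] \Po (l%:P + 'X)) * (Q i s 0 t).[l%:P]
    - \sum_s ((Q i k 0 s).[l%:P] \Po (u%:P + 'X)) * (Q j s 0 t).[u%:P] =
    \sum_s (P i j 0 s).[l%:P].[- (l + u)]%:P * (Q s k 0 t).[(l + u)%:P].

End BasisIdentities.

Section FreeJacobi.
Variables (F : numFieldType) (n m : nat).

Lemma free_act_eval k (Q : 'I_n -> 'I_k -> 'rV[{poly {poly F}}]_k) x v (l : F) t :
  (free_act_poly Q x v 0 t).[l%:P] =
  \sum_i \sum_j (x 0 i).[- l]%:P * (v 0 j \Po (l%:P + 'X)) * (Q i j 0 t).[l%:P].
Proof.
rewrite free_act_polyE horner_sum; apply: eq_bigr => i _.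
rewrite horner_sum; apply: eq_bigr => j _.
rewrite !hornerM horner_poly_XaY horner_comp; congr (_ * _ * _).
by rewrite hornerN hornerX -polyCN horner_map.
Qed.

Variable P : 'I_n -> 'I_n -> 'rV[{poly {poly F}}]_n.
Variable Q : 'I_n -> 'I_m -> 'rV[{poly {poly F}}]_m.

Hypothesis jacobi_basis : jacobi_on_basis P Q.

Let ev k (q : 'rV[{poly {poly F}}]_k) (l : F) : 'rV[{poly F}]_k :=
  \row_t (q 0 t).[l%:P].

Lemma free_act_eval_poly k (T : 'I_n -> 'I_k -> 'rV[{poly {poly F}}]_k)
    x (q : nat -> 'rV[{poly F}]_k) N (l u : F) t :
  (\sum_(i < N) (free_act_poly T x (q i) 0 t).[l%:P] * u%:P ^+ i) =
  (free_act_poly T x (\sum_(i < N) u%:P ^+ i *: q i) 0 t).[l%:P].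
Proof.
elim: N => [|N IHN].
  rewrite !big_ord0 free_act_eval big1 // => i _; rewrite big1 // => j _.
  by rewrite mxE comp_poly0 mulr0 mul0r.
rewrite !big_ord_recr /= IHN -rmorphXn [LHS]addrC.
rewrite [in RHS]addrC free_act_polyPr [in RHS]rowDE [in RHS]rowZE.
by rewrite hornerD hornerM hornerC mulrC.
Qed.

Lemma free_act_eval_polyl k (T : 'I_n -> 'I_k -> 'rV[{poly {poly F}}]_k)
    (q : nat -> 'rV[{poly F}]_n) v N (l u : F) t :
  (\sum_(i < N) u%:P ^+ i * (free_act_poly T (q i) v 0 t).[l%:P]) =
  (free_act_poly T (\sum_(i < N) u%:P ^+ i *: q i) v 0 t).[l%:P].
Proof.
elim: N => [|N IHN].
  rewrite !big_ord0 free_act_eval big1 // => i _; rewrite big1 // => j _.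
  by rewrite mxE horner0 !mul0r.
rewrite !big_ord_recr /= IHN -rmorphXn [LHS]addrC.
rewrite [in RHS]addrC free_act_polyPl [in RHS]rowDE [in RHS]rowZE.
by rewrite hornerD hornerM hornerC.
Qed.

Lemma free_act_sum k (T : 'I_n -> 'I_k -> 'rV[{poly {poly F}}]_k) x v N (l : F) :
  (forall t, (size (free_act_poly T x v 0%R t) <= N)%N) ->
  \sum_(i < N) l%:P ^+ i *: free_act T x v i = ev (free_act_poly T x v) l.
Proof.
move=> leN; apply/rowP => t; rewrite summxE mxE (horner_coef_wide _ (leN t)).
by apply: eq_bigr => i _; rewrite [LHS]rowZE free_actE mulrC.
Qed.

Lemma free_act_jacobi : lambda_jacobi (free_act P) (free_act Q).
Proof.
move=> x y v a b; apply/rowP => t.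
pose qy := free_act_poly Q y v; pose qx := free_act_poly Q x v.
pose p := free_act_poly P x y.
have [N [leqy leqx lep]] : exists N, [/\ forall t, (size (qy 0%R t) <= N)%N,
    forall t, (size (qx 0%R t) <= N)%N & forall t, (size (p 0%R t) <= N)%N].
  move: qy qx p => qy qx p.
  exists (row_size qy + (row_size qx + row_size p))%N; split=> t'.
  - exact: leq_trans (leq_row_size qy t') (leq_addr _ _).
  - exact: leq_trans (leq_row_size qx t') (leq_trans (leq_addr _ _) (leq_addl _ _)).
  - exact: leq_trans (leq_row_size p t') (leq_trans (leq_addl _ _) (leq_addl _ _)).
pose A1 : {poly {poly {poly F}}} := \poly_(i < N) free_act_poly Q x (free_act Q y v i) 0 t.
pose A2 : {poly {poly {poly F}}} := \sum_(i < N) ('X^i)%:P *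
  map_poly polyC (free_act_poly Q y (free_act Q x v i) 0 t).
pose A3 : {poly {poly {poly F}}} := \sum_(i < N) ('X^i)%:P *
  poly_XaY (free_act_poly Q (free_act P x y i) v 0 t).
have act0r k (T : 'I_n -> 'I_k -> 'rV[{poly {poly F}}]_k) z : free_act_poly T z 0 = 0.
  by rewrite -[0](subrr 0) -scaleN1r -polyCN addrC free_act_polyPr polyCN polyCN scaleN1r addNr.
have act0l k (T : 'I_n -> 'I_k -> 'rV[{poly {poly F}}]_k) z : free_act_poly T 0 z = 0.
  by rewrite -[0](subrr 0) -scaleN1r -polyCN addrC free_act_polyPl polyCN polyCN scaleN1r addNr.
have E1 : A1`_b`_a = free_act Q x (free_act Q y v b) a 0 t.
  rewrite coef_poly free_actE; case: ltnP => // leNb.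
  by rewrite (free_act_eq0 leqy) // act0r row0E coef0.
have E2 : A2`_b`_a = free_act Q y (free_act Q x v a) b 0 t.
  rewrite /A2 coef_sum coef_sum free_actE.
  under eq_bigr => i _ do rewrite coefCM coef_map coefMC coefXn.
  case: (ltnP a N) => [lta|lea].
    rewrite (bigD1 (Ordinal lta)) //= eqxx mul1r big1 ?addr0 // => i ne.
    have /negPf -> : a != i :> nat by apply: contraNneq ne => ai; apply/eqP/val_inj.
    by rewrite mul0r.
  rewrite (free_act_eq0 leqx) // act0r row0E coef0 big1 // => i _.
  by rewrite gtn_eqF ?mul0r //; apply: leq_trans lea.
have E3 : A3`_b`_a = (\sum_(i < a.+1)
    free_act Q (free_act P x y i) v (a - i + b)%N *+ 'C(a - i + b, b)) 0 t.
  rewrite /A3 coef_sum coef_sum summxE.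
  under eq_bigr => i _ do rewrite coefCM coefXnM coef_poly_XaY.
  under [RHS]eq_bigr => i _ do rewrite mulmxnE free_actE.
  pose G i := (free_act_poly Q (free_act P x y i) v 0 t)`_(a - i + b) *+ 'C(a - i + b, b).
  rewrite (eq_bigr (fun i : 'I_N => if (i <= a)%N then G i else 0)); last first.
    by move=> i _; rewrite ltnNge; case: (i <= a)%N.
  rewrite -big_mkcond /= (big_ord_widen_cond (maxn N a.+1) (fun i => i <= a)%N G) ?leq_maxl //.
  rewrite [RHS](big_ord_widen _ G (leq_maxr N a.+1)).
  rewrite [RHS](bigID (fun i : 'I_ _ => (i < N)%N)) /= [X in _ = _ + X]big1 ?addr0.
    by apply: eq_bigl => i; rewrite ltnS.
  move=> i /andP[_]; rewrite -leqNgt => leNi.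
  by rewrite /G (free_act_eq0 lep) // act0l row0E coef0 mul0rn.
rewrite [LHS]rowDE [X in _ + X]rowNE -[X in X - _]E1 -[X in _ - X]E2 -[RHS]E3 -!coefN -!coefD; suff -> : A1 - A2 = A3 by [].
move=> {E1 E2 E3}.
apply: poly2_ext => u l.
have E1 : A1.[u%:P%:P].[l%:P] = (free_act_poly Q x (ev qy u) 0 t).[l%:P].
  rewrite -(free_act_sum u leqy) -free_act_eval_poly horner_poly horner_sum.
  by apply: eq_bigr => i _; rewrite hornerM horner_exp hornerC.
have E2 : A2.[u%:P%:P].[l%:P] = (free_act_poly Q y (ev qx l) 0 t).[u%:P].
  rewrite -(free_act_sum l leqx) -free_act_eval_poly !horner_sum.
  apply: eq_bigr => i _; rewrite hornerM hornerC hornerM hornerXn mulrC.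
  by rewrite horner_map hornerC.
have E3 : A3.[u%:P%:P].[l%:P] = (free_act_poly Q (ev p l) v 0 t).[(l + u)%:P].
  rewrite -(free_act_sum l lep) -free_act_eval_polyl !horner_sum.
  apply: eq_bigr => i _; rewrite hornerM hornerC hornerM hornerXn.
  by rewrite horner_poly_XaY horner_comp hornerD hornerC hornerX polyCD [u%:P + _]addrC.
rewrite hornerD hornerN hornerD hornerN E1 E2 E3.
rewrite [X in X - _]free_act_eval [X in _ - X]free_act_eval [RHS]free_act_eval {E1 E2 E3 A1 A2 A3 act0r act0l}.
pose c i j k := (x 0 i).[- l]%:P * (y 0 j).[- u]%:P * (v 0 k \Po ((l + u)%:P + 'X)).
transitivity (\sum_i \sum_j \sum_k c i j k *
    \sum_s ((Q j k 0 s).[u%:P] \Po (l%:P + 'X)) * (Q i s 0 t).[l%:P]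
  - \sum_i \sum_j \sum_k c i j k *
    \sum_s ((Q i k 0 s).[l%:P] \Po (u%:P + 'X)) * (Q j s 0 t).[u%:P]).
  congr (_ - _).
    apply: eq_bigr => i _; under [RHS]eq_bigr => j _.
      under eq_bigr => k _ do rewrite mulr_sumr.
      rewrite exchange_big; over.
    rewrite [RHS]exchange_big; apply: eq_bigr => s _ /=.
    rewrite mxE free_act_eval !raddf_sum mulr_sumr mulr_suml.
    apply: eq_bigr => j _; rewrite raddf_sum mulr_sumr mulr_suml.
    apply: eq_bigr => k _; rewrite /= !comp_polyM comp_polyC -comp_polyA comp_polyD.
    by rewrite comp_polyC comp_polyX /c polyCD [l%:P + u%:P]addrC -addrA; ring.
  rewrite [RHS]exchange_big; apply: eq_bigr => j _; under [RHS]eq_bigr => i _.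
    under eq_bigr => k _ do rewrite mulr_sumr.
    rewrite exchange_big; over.
  rewrite [RHS]exchange_big; apply: eq_bigr => s _ /=.
  rewrite mxE free_act_eval !raddf_sum mulr_sumr mulr_suml.
  apply: eq_bigr => i _; rewrite raddf_sum mulr_sumr mulr_suml.
  apply: eq_bigr => k _; rewrite /= !comp_polyM comp_polyC -comp_polyA comp_polyD.
  by rewrite comp_polyC comp_polyX /c polyCD -addrA; ring.
rewrite -sumrB; under eq_bigr => i _.
  rewrite -sumrB; under eq_bigr => j _.
    rewrite -sumrB; under eq_bigr => k _ do
      rewrite -mulrBr jacobi_basis mulr_sumr.
    rewrite exchange_big; over.
  rewrite exchange_big; over.
rewrite exchange_big; apply: eq_bigr => s _ /=.
under eq_bigr => i _ do rewrite exchange_big /=.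
rewrite exchange_big; apply: eq_bigr => k _ /=.
rewrite mxE free_act_eval horner_sum rmorph_sum !mulr_suml.
apply: eq_bigr => i _; rewrite horner_sum rmorph_sum !mulr_suml.
apply: eq_bigr => j _; rewrite !hornerM hornerC horner_comp !hornerE /= !rmorphM /c.
have -> : l + - (l + u) = - u by ring.
by ring.
Qed.

End FreeJacobi.

Section FreeSkew.
Variables (K : fieldType) (n : nat) (P : 'I_n -> 'I_n -> 'rV[{poly {poly K}}]_n).

Hypothesis skew_basis : skew_on_basis P.

Lemma sum_finsupp (V : lmodType {poly K}) (f : lpoly V) (G : nat -> {poly K}) N :
  (forall k, (N <= k)%N -> f k = 0) ->
  \sum_(k <- finsupp f) G k *: f k = \sum_(k < N) G k *: f k.
Proof.
move=> f0; rewrite -(big_mkord xpredT (fun k => G k *: f k)) /index_iota subn0.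
rewrite [RHS](bigID (fun k => k \in finsupp f)) /= [X in _ + X]big1 ?addr0; last first.
  by move=> k; rewrite memNfinsupp => /eqP ->; rewrite scaler0.
rewrite -[RHS]big_filter; apply: perm_big; apply: uniq_perm.
- exact: fset_uniq.
- by rewrite filter_uniq ?iota_uniq.
move=> k; rewrite mem_filter mem_iota /= add0n.
have [|] := boolP (k \in finsupp f) => //=.
by rewrite mem_finsupp; case: ltnP => // /f0 ->; rewrite eqxx.
Qed.

Lemma free_act_poly_skew x y t :
  free_act_poly P x y 0 t = - (free_act_poly P y x 0 t \Po (- 'X - 'X%:P)).
Proof.
rewrite [LHS]free_act_polyE [X in _ = - (X \Po _)]free_act_polyE.
rewrite [LHS]exchange_big /=.
rewrite raddf_sum -sumrN.
apply: eq_bigr => j _; rewrite raddf_sum -sumrN; apply: eq_bigr => i _ /=.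
rewrite skew_basis !comp_polyM mulrN /poly_XaY -!comp_polyA; congr (- (_ * _)).
rewrite mulrC; congr (_ * _); congr (_ \Po _).
  by rewrite -(opprK ('X + _)) opprD; rewrite !rmorphN /= comp_polyX.
by rewrite comp_polyD comp_polyX comp_polyC subrK.
Qed.

Lemma free_act_skew : lambda_skew (free_act P).
Proof.
move=> x y k; apply/rowP => t; rewrite [LHS]free_actE.
set N := row_size (free_act_poly P y x).
have leN t' : (size (free_act_poly P y x 0%R t') <= N)%N by exact: leq_row_size.
rewrite [RHS]rowNE (sum_finsupp _ (fun k => free_act_eq0 leN)) summxE.
rewrite free_act_poly_skew coefN; congr (- _).
have leN' : (size (map_poly polyC (free_act_poly P y x 0%R t)) <= N)%N.
  by rewrite size_map_polyC.
rewrite /comp_poly (horner_coef_wide _ leN') coef_sum.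
apply: eq_bigr => i _; rewrite coef_map coefCM [RHS]rowZE free_actE.
by rewrite mulrC.
Qed.

End FreeSkew.

Section FreeLieConformal.
Variables (F : numFieldType) (n : nat) (P : 'I_n -> 'I_n -> 'rV[{poly {poly F}}]_n).

Definition freeLieConformal (skewP : skew_on_basis P) (jacP : jacobi_on_basis P P) :
    lieConformalAlgebra F :=
  LieConformalAlgebra (free_act_sesquilinear P)
    (free_act_skew skewP) (free_act_jacobi jacP).

Definition freeConformalModule skewP jacP m (Q : 'I_n -> 'I_m -> 'rV_m)
    (jacQ : jacobi_on_basis P Q) : conformalModule (@freeLieConformal skewP jacP) :=
  @ConformalModule _ (freeLieConformal skewP jacP) _ _
    (free_act_sesquilinear Q) (free_act_jacobi jacQ).

End FreeLieConformal.

Section TSV.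
Variable F : numFieldType.
Implicit Types a b c alpha beta gamma : F.

Local Notation cst a := (a%:P%:P : {poly {poly F}}).
Local Notation lam := ('X : {poly {poly F}}).
Local Notation del := ('X%:P : {poly {poly F}}).

Definition genL : 'I_3 := @Ordinal 3 0 isT.
Definition genY : 'I_3 := @Ordinal 3 1 isT.
Definition genM : 'I_3 := @Ordinal 3 2 isT.

Local Notation basis i := (delta_mx 0 i : 'rV[{poly {poly F}}]_3).

(* Structure polynomials [e_i λ e_j] with e_0, e_1, e_2 = L, Y, M, given      *)
(* for i <= j and completed by [e_j λ e_i] = - [e_i {-λ-∂} e_j].              *)
Definition skew_completion (T : nat -> nat -> 'rV[{poly {poly F}}]_3)
    (i j : 'I_3) : 'rV[{poly {poly F}}]_3 :=
  if (i <= j)%N then T i j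
  else - map_mx (fun q => q \Po (- lam - del)) (T j i).

Definition TSV_table a b : 'I_3 -> 'I_3 -> 'rV[{poly {poly F}}]_3 :=
  skew_completion (fun i j =>
    match i, j with
    | 0%N, 0%N => (del + lam *+ 2) *: basis genL
    | 0%N, 1%N => (del + cst a * lam + cst b) *: basis genY
    | 0%N, 2%N => (del + cst ((a - 1) *+ 2) * lam + cst (b *+ 2)) *: basis genM
    | 1%N, 1%N => (del + lam *+ 2) *: basis genM
    | _, _ => 0
    end).

Definition TSVc_table c : 'I_3 -> 'I_3 -> 'rV[{poly {poly F}}]_3 :=
  skew_completion (fun i j =>
    match i, j with
    | 0%N, 0%N => (del + lam *+ 2) *: basis genL
    | 0%N, 1%N => (del + cst (3%:R / 2%:R) * lam + cst c) *: basis genY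
    | 0%N, 2%N => (del + cst (c *+ 2)) *: basis genM
    | 1%N, 1%N => ((del + lam *+ 2) * (- del - cst (c *+ 2))) *: basis genM
    | _, _ => 0
    end).

(* L_λ v = l v, Y_λ v = y v, M_λ v = 0 on a module with one generator v *)
Definition rank1_table (l y : {poly {poly F}}) (i : 'I_3) (_ : 'I_1) :
    'rV[{poly {poly F}}]_1 :=
  const_mx (match nat_of_ord i with 0%N => l | 1%N => y | _ => 0 end).

Lemma skew_completion_skew (T : nat -> nat -> 'rV[{poly {poly F}}]_3) :
  (forall (i : 'I_3) t, T i i 0 t = - (T i i 0 t \Po (- 'X - 'X%:P))) ->
  skew_on_basis (skew_completion T).
Proof.
move=> diag i j t; rewrite /skew_completion.
have involK (q : {poly {poly F}}) : q \Po (- 'X - 'X%:P) \Po (- 'X - 'X%:P) = q.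
  rewrite -comp_polyA comp_polyB comp_polyC.
  rewrite (rmorphN (comp_poly _)) /= comp_polyX.
  by rewrite opprD !opprK addrK comp_polyXr.
case: (ltngtP i j) => [_|_|/val_inj <-]; last exact: diag.
  by rewrite [X in - (X \Po _)]rowNE [X in - X \Po _]mxE rmorphN opprK /= involK.
by rewrite [LHS]rowNE mxE.
Qed.
Lemma TSV_skew a b : skew_on_basis (TSV_table a b).
Proof.
apply: skew_completion_skew => -[[|[|[|//]]] ?] t;
  rewrite /= !mxE ?mulr0 ?comp_poly0 ?oppr0 // -(rmorphMn polyC) /=.

all: by rewrite !(comp_polyD, comp_polyM, comp_polyC, comp_polyX, mulr2n); ring.
Qed.

Lemma comp_polyN (R : nzRingType) (p q : {poly R}) : (- p) \Po q = - (p \Po q).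
Proof. exact: raddfN. Qed.

(* e_i, e_j have bracket in K[λ,∂] e_{i+j}, where L, Y, M have degree 0, 1, 2 *)
Definition gen_add (i j : 'I_3) : 'I_3 := inord (i + j).

Lemma jacobi_graded (p : 'I_3 -> 'I_3 -> {poly {poly F}})
    (T : 'I_3 -> 'I_3 -> 'rV[{poly {poly F}}]_3) :
  (forall i j, T i j = p i j *: delta_mx 0 (gen_add i j)) ->
  (forall i j : 'I_3, (2 < i + j)%N -> p i j = 0) ->
  (forall (l u : F) (i j k : 'I_3), (i + j + k <= 2)%N ->
    ((p j k).[u%:P] \Po (l%:P + 'X)) * (p i (gen_add j k)).[l%:P]
    - ((p i k).[l%:P] \Po (u%:P + 'X)) * (p j (gen_add i k)).[u%:P] =
    (p i j).[l%:P].[- (l + u)]%:P * (p (gen_add i j) k).[(l + u)%:P]) ->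
  jacobi_on_basis T T.
Proof.
move=> TE p0 H l u i j k t.
have pick (f g : 'I_3 -> {poly F}) (d : 'I_3) : (forall s, s != d -> f s = 0) ->
    \sum_s f s * g s = f d * g d.
  by move=> f0; rewrite (bigD1 d) //= big1 ?addr0 // => s /f0 ->; rewrite mul0r.
have Toff i' j' s : s != gen_add i' j' -> T i' j' 0 s = 0.
  by move=> /negPf ne; rewrite TE !mxE ne mulr0.
have Ton i' j' : T i' j' 0 (gen_add i' j') = p i' j' by rewrite TE !mxE !eqxx mulr1.
rewrite (pick _ _ (gen_add j k)); last by move=> s /Toff ->; rewrite horner0 comp_poly0.
rewrite (pick _ _ (gen_add i k)); last by move=> s /Toff ->; rewrite horner0 comp_poly0.
rewrite (pick _ _ (gen_add i j)); last by move=> s /Toff ->; rewrite !horner0.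
rewrite !Ton.
have gen_addE (i' j' : 'I_3) : (i' + j' <= 2)%N -> gen_add i' j' = (i' + j')%N :> nat.
  by move=> le; rewrite /gen_add inordK.
have T0 (i' j' : 'I_3) s : (2 < i' + j')%N -> T i' j' 0 s = 0.
  by move=> lt; rewrite TE p0 // scale0r mxE.
have [le2|gt2] := leqP (i + j + k) 2; last first.
  have zero (i' j' k' : 'I_3) : (i' + j' + k' = i + j + k)%N ->
      p i' j' = 0 \/ forall s, T (gen_add i' j') k' 0 s = 0.
    move=> e; have [le|/p0 ->] := leqP (i' + j') 2; last by left.
    by right=> s; apply: T0; rewrite gen_addE // e.
  have zero' (i' j' k' : 'I_3) : (i' + j' + k' = i + j + k)%N ->
      p i' j' = 0 \/ forall s, T k' (gen_add i' j') 0 s = 0.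
    move=> e; have [le|/p0 ->] := leqP (i' + j') 2; last by left.
    by right=> s; apply: T0; rewrite gen_addE // addnC e.
  case: (zero i j k) => // ->; rewrite ?(horner0, mul0r, mulr0);
  (case: (zero' j k i); [by rewrite addnC addnA|move=> ->|move=> ->]);
  rewrite ?(horner0, comp_poly0, mul0r, mulr0);
  (case: (zero' i k j); [by rewrite addnAC|move=> ->|move=> ->]);
  by rewrite ?(horner0, comp_poly0, mul0r, mulr0) subrr.
have lejk : (j + k <= 2)%N by apply: leq_trans le2; rewrite -addnA leq_addl.
have leij : (i + j <= 2)%N by apply: leq_trans le2; rewrite leq_addr.
have leik : (i + k <= 2)%N by apply: leq_trans le2; rewrite addnAC leq_addr.
have v1 : gen_add j (gen_add i k) = (i + j + k)%N :> nat.
  by rewrite gen_addE; rewrite (gen_addE _ _ leik) addnCA addnA.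
have v2 : gen_add i (gen_add j k) = (i + j + k)%N :> nat.
  by rewrite gen_addE; rewrite (gen_addE _ _ lejk) addnA.
have v3 : gen_add (gen_add i j) k = (i + j + k)%N :> nat.
  by rewrite gen_addE; rewrite (gen_addE _ _ leij).
have e1 : gen_add j (gen_add i k) = gen_add i (gen_add j k) by apply: val_inj; exact: etrans v1 (esym v2).
have e2 : gen_add (gen_add i j) k = gen_add i (gen_add j k) by apply: val_inj; exact: etrans v3 (esym v2).
have [-> |ne] := eqVneq t (gen_add i (gen_add j k)).
  have -> : T j (gen_add i k) 0 (gen_add i (gen_add j k)) = p j (gen_add i k) by rewrite -e1 Ton.
  have -> : T (gen_add i j) k 0 (gen_add i (gen_add j k)) = p (gen_add i j) k by rewrite -e2 Ton.
  by rewrite Ton H.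
rewrite [T i _ _ _]Toff // [T j _ _ _]Toff ?e1 // [T _ k _ _]Toff ?e2 //.
by rewrite !horner0 !mulr0 subrr.
Qed.

Definition skew_poly (p : nat -> nat -> {poly {poly F}}) (i j : 'I_3) :=
  if (i <= j)%N then p i j else - (p j i \Po (- 'X - 'X%:P)).

Lemma skew_completionE (p : nat -> nat -> {poly {poly F}})
    (T : nat -> nat -> 'rV[{poly {poly F}}]_3) :
  (forall i j : 'I_3, T i j = p i j *: delta_mx 0 (gen_add i j)) ->
  forall i j : 'I_3, skew_completion T i j = skew_poly p i j *: delta_mx 0 (gen_add i j).
Proof.
move=> TE i j; rewrite /skew_completion /skew_poly; case: ifP => _; first exact: TE.
rewrite TE; have -> : gen_add j i = gen_add i j by rewrite /gen_add addnC.
apply/rowP => t; rewrite !mxE mulNr comp_polyM; congr (- (_ * _)).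
by case: (_ && _); rewrite /= ?comp_poly0 ?comp_polyC.
Qed.

Lemma skew_jacobi (p : nat -> nat -> {poly {poly F}})
    (T : nat -> nat -> 'rV[{poly {poly F}}]_3) :
  (forall i j : 'I_3, T i j = p i j *: delta_mx 0 (gen_add i j)) ->
  (forall i j : nat, (2 < i + j)%N -> p i j = 0) ->
  (forall (l u : F) (i j k : 'I_3), (i + j + k <= 2)%N ->
    ((skew_poly p j k).[u%:P] \Po (l%:P + 'X)) * (skew_poly p i (gen_add j k)).[l%:P]
    - ((skew_poly p i k).[l%:P] \Po (u%:P + 'X)) * (skew_poly p j (gen_add i k)).[u%:P] =
    (skew_poly p i j).[l%:P].[- (l + u)]%:P * (skew_poly p (gen_add i j) k).[(l + u)%:P]) ->
  jacobi_on_basis (skew_completion T) (skew_completion T).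
Proof.
move=> TE p0 H; apply: (jacobi_graded (skew_completionE TE)) => // i j lt.
by rewrite /skew_poly; case: ifP => _; rewrite p0 ?comp_poly0 ?oppr0 // addnC.
Qed.


Lemma rank1_jacobi (p : nat -> nat -> {poly {poly F}})
    (T : nat -> nat -> 'rV[{poly {poly F}}]_3) (ql qy : {poly {poly F}}) :
  let q i : {poly {poly F}} := match i with 0%N => ql | 1%N => qy | _ => 0 end in
  (forall i j : 'I_3, T i j = p i j *: delta_mx 0 (gen_add i j)) ->
  (forall i j : nat, (2 < i + j)%N -> p i j = 0) ->
  (forall (l u : F) (i j : 'I_3),
    ((q j).[u%:P] \Po (l%:P + 'X)) * (q i).[l%:P]
    - ((q i).[l%:P] \Po (u%:P + 'X)) * (q j).[u%:P] =
    (skew_poly p i j).[l%:P].[- (l + u)]%:P * (q (i + j)%N).[(l + u)%:P]) ->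
  jacobi_on_basis (skew_completion T) (rank1_table ql qy).
Proof.
move=> q TE p0 H l u i j k t; rewrite !big_ord1 !mxE H.
rewrite (bigD1 (gen_add i j)) //= big1 ?addr0 => [|s /negPf ne]; last first.
  by rewrite (skew_completionE TE) !mxE ne mulr0 !horner0 mul0r.
rewrite (skew_completionE TE) !mxE !eqxx mulr1.
have [le|lt] := leqP (i + j) 2; first by rewrite /gen_add inordK.
have -> : skew_poly p i j = 0; last by rewrite !horner0 !mul0r.
by rewrite /skew_poly; case: ifP => _; rewrite p0 ?comp_poly0 ?oppr0 // addnC.
Qed.

Definition TSV_poly a b (i j : nat) : {poly {poly F}} :=
  match i, j with
  | 0%N, 0%N => 'X%:P + 'X *+ 2
  | 0%N, 1%N => 'X%:P + a%:P%:P * 'X + b%:P%:P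
  | 0%N, 2%N => 'X%:P + ((a - 1) *+ 2)%:P%:P * 'X + (b *+ 2)%:P%:P
  | 1%N, 1%N => 'X%:P + 'X *+ 2
  | _, _ => 0
  end.

Definition TSVc_poly h c (i j : nat) : {poly {poly F}} :=
  match i, j with
  | 0%N, 0%N => 'X%:P + 'X *+ 2
  | 0%N, 1%N => 'X%:P + h%:P%:P * 'X + c%:P%:P
  | 0%N, 2%N => 'X%:P + (c *+ 2)%:P%:P
  | 1%N, 1%N => ('X%:P + 'X *+ 2) * (- 'X%:P - (c *+ 2)%:P%:P)
  | _, _ => 0
  end.

Lemma TSV_poly0 a b (i j : nat) : (2 < i + j)%N -> TSV_poly a b i j = 0.
Proof. by case: i j => [|[|i]] [|[|[|j]]]. Qed.

Lemma TSVc_poly0 h c (i j : nat) : (2 < i + j)%N -> TSVc_poly h c i j = 0.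
Proof. by case: i j => [|[|i]] [|[|[|j]]]. Qed.

Lemma gen_add_val (i j : 'I_3) : (i + j <= 2)%N -> gen_add i j = (i + j)%N :> nat.
Proof. by move=> le; rewrite /gen_add inordK. Qed.

Lemma gen_addE (i j d : 'I_3) : (i + j = d)%N -> gen_add i j = d.
Proof. by rewrite /gen_add => ->; exact: inord_val. Qed.

Ltac grade_tac := move=> [[|[|[|//]]] ?] [[|[|[|//]]] ?] /=;
  rewrite ?scale0r //;
  first [by rewrite (@gen_addE _ _ genL) | by rewrite (@gen_addE _ _ genY) | by rewrite (@gen_addE _ _ genM)].

Ltac poly_tac :=
  rewrite ?mulr2n ?(hornerD, hornerN, hornerM, hornerC, hornerX, horner0,
    comp_polyD, comp_polyN, comp_polyM, comp_polyC, comp_polyX, comp_poly0);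
  rewrite ?(polyCD, polyCN, polyCM).

Lemma TSV_jacobi a b : jacobi_on_basis (TSV_table a b) (TSV_table a b).
Proof.
apply: (skew_jacobi (p := TSV_poly a b)); [by grade_tac | exact: TSV_poly0 |].
move=> l u; case=> [[|[|[|//]]] ?] [[|[|[|//]]] ?] [[|[|[|//]]] ?] //= _;
  by rewrite /skew_poly ?gen_add_val //= /TSV_poly; poly_tac; ring.
Qed.

Lemma TSVc_jacobi c : jacobi_on_basis (TSVc_table c) (TSVc_table c).
Proof.
have [h hE] : exists h : F, h = 3%:R / 2%:R by eexists.
have h2 : h%:P + h%:P - 3%:R = 0 :> {poly F}.
  by rewrite -polyCD -polyC_natr -polyCB hE; congr (_%:P); field.
apply: (skew_jacobi (p := TSVc_poly h c)); [by rewrite hE; grade_tac | exact: TSVc_poly0 |].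
move=> l u; case=> [[|[|[|//]]] ?] [[|[|[|//]]] ?] [[|[|[|//]]] ?] //= _;
  rewrite /skew_poly ?gen_add_val //= /TSVc_poly; poly_tac; try ring;
  apply/subr0_eq.
- transitivity ((h%:P + h%:P - 3%:R) * (l%:P * ('X + l%:P + u%:P *+ 2) * ('X + c%:P *+ 2))).
    ring.
  by rewrite h2 mul0r.
- transitivity (- (h%:P + h%:P - 3%:R) * (u%:P * ('X + u%:P + l%:P *+ 2) * ('X + c%:P *+ 2))).
    ring.
  by rewrite h2 oppr0 mul0r.
- transitivity (- (h%:P + h%:P - 3%:R) * (('X + l%:P + u%:P) * ('X + c%:P *+ 2) * (l%:P - u%:P))).
    ring.
  by rewrite h2 oppr0 mul0r.
Qed.

Lemma TSVc_skew c : skew_on_basis (TSVc_table c).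
Proof.
apply: skew_completion_skew => -[[|[|[|//]]] ?] t;
  rewrite /= !mxE ?mulr0 ?comp_poly0 ?oppr0 // -(rmorphMn polyC) /=;
  by poly_tac; ring.
Qed.

Definition M_L_poly alpha beta : {poly {poly F}} :=
  'X%:P + alpha%:P%:P * 'X + beta%:P%:P.

Lemma TSV_M_jacobi a b alpha beta :
  jacobi_on_basis (TSV_table a b) (rank1_table (M_L_poly alpha beta) 0).
Proof.
apply: (rank1_jacobi (p := TSV_poly a b)); [by grade_tac | exact: TSV_poly0 |].
move=> l u; case=> [[|[|[|//]]] ?] [[|[|[|//]]] ?] /=;
  by rewrite /skew_poly /= /TSV_poly /M_L_poly; poly_tac; ring.
Qed.

Lemma TSVc_M_jacobi c alpha beta :
  jacobi_on_basis (TSVc_table c) (rank1_table (M_L_poly alpha beta) 0).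
Proof.
apply: (rank1_jacobi (p := TSVc_poly (3%:R / 2%:R) c)); [by grade_tac | exact: TSVc_poly0 |].
move=> l u; case=> [[|[|[|//]]] ?] [[|[|[|//]]] ?] /=;
  by rewrite /skew_poly /= /TSVc_poly /M_L_poly; poly_tac; ring.
Qed.

Lemma TSV10_M_jacobi alpha beta gamma :
  jacobi_on_basis (TSV_table 1 0) (rank1_table (M_L_poly alpha beta) gamma%:P%:P).
Proof.
apply: (rank1_jacobi (p := TSV_poly 1 0)); [by grade_tac | exact: TSV_poly0 |].
move=> l u; case=> [[|[|[|//]]] ?] [[|[|[|//]]] ?] /=;
  by rewrite /skew_poly /= /TSV_poly /M_L_poly ?subrr ?mul0rn ?polyC0 ?polyC1; poly_tac; ring.
Qed.

Definition TSV a b := freeLieConformal (TSV_skew a b) (TSV_jacobi a b).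
Definition TSVc c := freeLieConformal (TSVc_skew c) (TSVc_jacobi c).
Definition TSV_M a b alpha beta : conformalModule (TSV a b) :=
  freeConformalModule _ _ (TSV_M_jacobi a b alpha beta).
Definition TSVc_M c alpha beta : conformalModule (TSVc c) :=
  freeConformalModule _ _ (TSVc_M_jacobi c alpha beta).
Definition TSV10_M alpha beta gamma : conformalModule (TSV 1 0) :=
  freeConformalModule _ _ (TSV10_M_jacobi alpha beta gamma).

End TSV.

(* Main.v *)
(* The coefficient operators x[n] = x_(n) / n! of L, Y, M, for n large, kill   *)
(* any given vector.  Let W be the smallest nonzero layer of vectors killed by *)
(* L[n], Y[n], M[n] beyond shifted thresholds.  Comparing top coefficients in  *)
(* λ, C-independent vectors of W are C[∂]-independent, so W has finite         *)
(* dimension and C[∂] acts freely on it.  On W act L[0] - ∂ and all L[n+1],    *)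
(* Y[n], M[n], and they have a joint eigenvector v: if [A, X] is k X, k <> 0,  *)
(* or a central multiple of a central X, then X has a kernel on W, which       *)
(* removes M, then Y, then L[n], n >= 2, from the top down, except that Y[0]   *)
(* survives as a scalar when it is central (a = 1, b = 0).  Then C[∂]v is a    *)
(* submodule, hence everything; if L[1] v = Y[0] v = 0 then the multiples      *)
(* of (∂ + β)v would form a proper one.                                        *)
From HB Require Import structures.
Require Import Defs.
From mathcomp Require Import all_boot all_order all_algebra.
From mathcomp Require Import reals complex.
From mathcomp Require Import finmap boolp ring zify.

Set Implicit Arguments.
Unset Strict Implicit.
Unset Printing Implicit Defensive.

Import GRing.Theory Num.Theory.
Local Open Scope ring_scope.
Local Open Scope complex_scope.

(** Write x[n] for the coefficient of λ^n in x_λ. Both families of algebras have the shape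
    [tsv_brackets], so one argument in the spirit of Lie's theorem serves for both: a nonzero
    subspace of finite dimension over C, stable under the relevant x[n], with L[0] replaced by T =
    L[0] - ∂, is cut down until a joint eigenvector remains.

    Finite generation over C[∂] is turned into finite dimension over C by [poly_independent] and
    [Fil_dim]: in the lowest nonzero layer, a C[∂]-relation splits into C-relations, because its top
    coefficient lands in the layer below, which is 0. Then [kill_M], [kill_Y] and [kill_L] lower the
    thresholds one operator at a time, each time because the operator is, up to a nonzero scalar,
    its own commutator with another one ([nilpotent_kernel]) or a central commutator
    ([heisenberg_kernel]).

    What is left is T, L[1] and, only if [L_λ Y] = (∂ + λ) Y, also Y[0]; [joint_eigenvector] gives a
    common eigenvector v. It generates a free C[∂]-module by [poly_independent], and this is
    everything by irreducibility. Its eigenvalues determine V ([rank1_generator_iso]), and those of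
    L[1] and Y[0] cannot both vanish, since otherwise some (∂ + β) v would generate a proper
    submodule ([rank1_generator_ex]). *)

Lemma left_dependence (R : idomainType) n (c : 'I_n.+1 -> 'I_n -> R) :
  exists p : 'I_n.+1 -> R,
    (exists i, p i != 0) /\ forall j, \sum_i p i * c i j = 0.
Proof.
(* A zero column is added to make the matrix square and singular. *)
pose A : 'M[R]_n.+1 :=
  \matrix_(i, j) if unlift ord0 j is Some j' then c i j' else 0.
have /det0P[u u0 uA] : \det A == 0.
  by rewrite (expand_det_col A ord0) big1 // => i _; rewrite mxE unlift_none mul0r.
exists (u 0); split.
  by case/rV0Pn: u0 => i; exists i.
move=> j; have /rowP/(_ (lift ord0 j)) := uA; rewrite !mxE => E.
rewrite -[RHS]E.
by apply: eq_bigr => i _; rewrite mxE liftK.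
Qed.

(** * Eigenvectors and commutators of C-linear operators on finite-dimensional subspaces *)

Section Operators.
Variables (F : numClosedFieldType) (V : lmodType {poly F}).
Implicit Types (W : V -> Prop) (X A B : V -> V) (u v w : V) (p q : {poly F}).

Definition klinear X := forall c u w, X (c%:P *: u + w) = c%:P *: X u + X w.

Lemma klinear0 X : klinear X -> X 0 = 0.
Proof. by move=> /(_ (-1) 0 0); rewrite scaler0 addr0 polyCN scaleN1r addNr. Qed.

Lemma klinearD X u w : klinear X -> X (u + w) = X u + X w.
Proof. by move=> /(_ 1 u w); rewrite !scale1r. Qed.

Lemma klinearZ X c u : klinear X -> X (c%:P *: u) = c%:P *: X u.
Proof. by move=> lX; have := lX c u 0; rewrite (klinear0 lX) !addr0. Qed.

Lemma klinear_sum X I (r : seq I) (c : I -> F) (f : I -> V) : klinear X ->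
  X (\sum_(i <- r) (c i)%:P *: f i) = \sum_(i <- r) (c i)%:P *: X (f i).
Proof.
move=> lX; elim: r => [|i r IH]; first by rewrite !big_nil (klinear0 lX).
by rewrite !big_cons lX IH.
Qed.

Definition subspace W := W 0 /\ forall c u w, W u -> W w -> W (c%:P *: u + w).

Lemma subspace_sum W I (r : seq I) (c : I -> F) (f : I -> V) : subspace W ->
  (forall i, W (f i)) -> W (\sum_(i <- r) (c i)%:P *: f i).
Proof.
move=> [W0 WP] Wf; elim: r => [|i r IH]; first by rewrite big_nil.
by rewrite big_cons; apply: WP.
Qed.

Definition stable W X := forall w, W w -> W (X w).

(** Finite dimension without a choice of basis: this suffices to get annihilating polynomials and
    passes to subspaces. *)
Definition dim_le W r := forall f : 'I_r.+1 -> V, (forall i, W (f i)) ->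
  exists c : 'I_r.+1 -> F, (exists i, c i != 0) /\ \sum_i (c i)%:P *: f i = 0.

Lemma dim_leS W W' r : (forall w, W' w -> W w) -> dim_le W r -> dim_le W' r.
Proof. by move=> sub dW f Wf; apply: dW => i; apply: sub. Qed.

(** This is q(X) u, for an operator X that need not be the action of ∂. *)
Definition opoly X u q : V := \sum_(i < size q) (q`_i)%:P *: iter i X u.

Lemma opoly_wide X u q n : (size q <= n)%N ->
  opoly X u q = \sum_(i < n) (q`_i)%:P *: iter i X u.
Proof.
move=> le; rewrite /opoly (big_ord_widen n (fun i => (q`_i)%:P *: iter i X u)) //.
rewrite big_mkcond; apply: eq_bigr => i _; case: ltnP => // le'.
by rewrite nth_default // scale0r.
Qed.

Lemma opolyP X u c p q : opoly X u (c *: p + q) = c%:P *: opoly X u p + opoly X u q.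
Proof.
pose n := maxn (size p) (size q).
rewrite !(@opoly_wide _ _ _ n) ?leq_maxl ?leq_maxr //; last first.
  by rewrite (leq_trans (size_polyD _ _)) // geq_max leq_maxr andbT
    (leq_trans (size_scale_leq _ _)) ?leq_maxl.
rewrite scaler_sumr -big_split; apply: eq_bigr => i _ /=.
by rewrite coefD coefZ polyCD polyCM scalerDl scalerA.
Qed.

Lemma opoly0 X u : opoly X u 0 = 0.
Proof. by rewrite /opoly size_poly0 big_ord0. Qed.

Lemma opolyC X u c : opoly X u c%:P = c%:P *: u.
Proof.
by rewrite (@opoly_wide _ _ _ 1) ?size_polyC ?leq_b1 // big_ord1 coefC.
Qed.

Lemma opolyMX X u p : klinear X -> opoly X u (p * 'X) = X (opoly X u p).
Proof.
move=> lX; rewrite (@opoly_wide _ _ (p * 'X) (size p).+1); last first.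
  by rewrite (leq_trans (size_polyMleq _ _)) // size_polyX addn2.
rewrite big_ord_recl coefMX /= scale0r add0r /opoly klinear_sum //.
by apply: eq_bigr => i _; rewrite coefMX.
Qed.

Lemma opolyD X u p q : opoly X u (p + q) = opoly X u p + opoly X u q.
Proof. by have := opolyP X u 1 p q; rewrite !scale1r. Qed.

Lemma opoly_in W X u p : subspace W -> stable W X -> W u -> W (opoly X u p).
Proof.
move=> sW WX Wu; apply: subspace_sum => // i.
by elim: (nat_of_ord i) => //= n; apply: WX.
Qed.

Definition minimal_annihilator X u q :=
  [/\ q != 0, opoly X u q = 0 &
    forall p, p != 0 -> (size p < size q)%N -> opoly X u p != 0].

Lemma minimal_annihilator_ex W X u r : subspace W -> dim_le W r -> stable W X ->
  W u -> exists q, minimal_annihilator X u q.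
Proof.
move=> sW dW WX Wu.
pose P n := `[< exists q, [/\ q != 0, opoly X u q = 0 & size q = n] >].
have exP : exists n, P n.
  have [i|c [[i ci] c0]] := dW (fun i : 'I_r.+1 => iter i X u).
    by elim: (nat_of_ord i) => //= n; apply: WX.
  pose q := \poly_(i < r.+1) c (inord i).
  exists (size q); apply/asboolP; exists q; split=> //.
    apply: contra ci => /eqP/polyP/(_ i).
    by rewrite coef_poly ltn_ord inord_val coef0 => ->.
  rewrite (@opoly_wide _ _ _ r.+1) ?size_poly // -[RHS]c0.
  by apply: eq_bigr => j _; rewrite coef_poly ltn_ord inord_val.
case: (ex_minnP exP) => n /asboolP.
move=> [q [q0 qu qn]] min; exists q; split=> // p p0 lt; apply/eqP => pu.
by move: lt; rewrite qn ltnNge min //; apply/asboolP; exists p.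
Qed.

Lemma minimal_annihilator_size X u q : u <> 0 -> minimal_annihilator X u q ->
  (1 < size q)%N.
Proof.
move=> u0 [q0 qu _]; rewrite ltnNge; apply: contra q0 => /size1_polyC qE.
move: qu; rewrite qE opolyC => E; rewrite polyC_eq0; apply/negP => /negP c0.
apply: u0; rewrite -[u]scale1r -polyC1 -(mulVf c0) polyCM -scalerA E.
by rewrite scaler0.
Qed.

(** The minimal annihilator q of a vector u has a root rho. If q = p ('X - rho), then p(X) u is
    nonzero by minimality, and X - rho kills it. *)
Lemma eigenvector W X r : subspace W -> dim_le W r -> klinear X -> stable W X ->
  (exists2 w, W w & w <> 0) ->
  exists rho w, [/\ W w, w <> 0 & X w = rho%:P *: w].
Proof.
move=> sW dW lX WX [u Wu u0].
have [q mq] := minimal_annihilator_ex sW dW WX Wu.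
have szq := minimal_annihilator_size u0 mq; case: mq => q0 qu qmin.
have [|rho /factor_theorem[p qE]] := closed_rootP q _; first by rewrite gtn_eqF.
have p0 : p != 0 by apply: contraNneq q0 => pE; rewrite qE pE mul0r.
exists rho, (opoly X u p); split; first exact: opoly_in.
  apply/eqP/qmin => //.
  by rewrite qE size_Mmonic ?monicXsubC // size_XsubC addn2.
apply/eqP; rewrite -subr_eq0; apply/eqP; rewrite -[RHS]qu qE mulrBr addrC.
by rewrite opolyD opolyMX // [p * _]mulrC -mulNr -polyCN mul_polyC
  -[_ *: p]addr0 opolyP opoly0 addr0 polyCN scaleNr addrC.
Qed.

(* If A u = alpha u then A q(X) u = alpha q(X) u + g(X) q'(X) u for every q,   *)
(* where [A, X] = g(X); take q minimal with q(X) u = 0.                        *)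
Lemma commutator_kernel W A X r (k chi : F) :
  subspace W -> dim_le W r -> klinear A -> klinear X -> stable W A -> stable W X ->
  (forall w, W w -> A (X w) = X (A w) + (k%:P *: X w + chi%:P *: w)) ->
  (exists2 w, W w & w <> 0) ->
  exists w, [/\ W w, w <> 0 & k%:P *: X w + chi%:P *: w = 0].
Proof.
move=> sW dW lA lX WA WX AX neW.
have [alpha [u [Wu u0 Au]]] := eigenvector sW dW lA WA neW.
have [q mq] := minimal_annihilator_ex sW dW WX Wu.
have szq := minimal_annihilator_size u0 mq; case: mq => q0 qu qmin.
have der p : A (opoly X u p) = alpha%:P *: opoly X u p +
    (k%:P *: X (opoly X u p^`()) + chi%:P *: opoly X u p^`()).
  elim/poly_ind: p => [|p c IH].
    by rewrite deriv0 opoly0 (klinear0 lA) (klinear0 lX) !scaler0 !addr0.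
  have Wp := opoly_in p sW WX Wu.
  rewrite derivD derivC addr0 derivM derivX mulr1 !opolyD opolyC !opolyMX //.
  rewrite (klinearD _ _ lA) (klinearZ _ _ lA) AX // IH Au !(klinearD _ _ lX).
  rewrite !(klinearZ _ _ lX) !scalerDr !scalerA [c%:P * _]mulrC.
  rewrite -!addrA; congr (_ + _); rewrite [RHS]addrC -!addrA; congr (_ + _).
  by rewrite addrCA.
(* Characteristic zero. By minimality of q, the vector q'(X) u is then nonzero, and it is the
   witness. *)
have q'0 : q^`() != 0.
  apply/eqP => /polyP/(_ (size q).-2); rewrite coef_deriv coef0 => /eqP.
  rewrite (_ : (size q).-2.+1 = (size q).-1); last by case: (size q) szq => [|[]].
  rewrite -lead_coefE -mulr_natr mulf_eq0 lead_coef_eq0 (negPf q0) pnatr_eq0 /=.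
  by case: (size q) szq => [|[]].
exists (opoly X u q^`()); split; first exact: opoly_in.
  by apply/eqP/qmin => //; apply: lt_size_deriv.
by have := der q; rewrite qu (klinear0 lA) scaler0 add0r => <-.
Qed.

Lemma nilpotent_kernel W A X r (k : F) :
  subspace W -> dim_le W r -> klinear A -> klinear X -> stable W A -> stable W X ->
  k != 0 -> (forall w, W w -> A (X w) = X (A w) + k%:P *: X w) ->
  (exists2 w, W w & w <> 0) ->
  exists w, [/\ W w, w <> 0 & X w = 0].
Proof.
move=> sW dW lA lX WA WX k0 AX neW.
have AX' w : W w -> A (X w) = X (A w) + (k%:P *: X w + 0%:P *: w).
  by move=> Ww; rewrite AX // scale0r addr0.
have [w [Ww w0 Xw]] := commutator_kernel sW dW lA lX WA WX AX' neW.
exists w; split=> //; rewrite -[X w]scale1r -polyC1 -(mulVf k0) polyCM -scalerA.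
by move: Xw; rewrite scale0r addr0 => ->; rewrite scaler0.
Qed.

(** A commutator has trace zero, so X has no eigenvalue chi <> 0. In place of the trace,
    [commutator_kernel] is applied on the chi-eigenspace of X, where [A, B] is the scalar k chi. *)
Lemma heisenberg_kernel W A B X r (k : F) :
  subspace W -> dim_le W r -> klinear A -> klinear B -> klinear X ->
  stable W A -> stable W B -> stable W X -> k != 0 ->
  (forall w, W w -> A (B w) = B (A w) + k%:P *: X w) ->
  (forall w, W w -> A (X w) = X (A w)) -> (forall w, W w -> B (X w) = X (B w)) ->
  (exists2 w, W w & w <> 0) ->
  exists w, [/\ W w, w <> 0 & X w = 0].
Proof.
move=> sW dW lA lB lX WA WB WX k0 AB AX BX neW.
have [chi [w [Ww w0 Xw]]] := eigenvector sW dW lX WX neW.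
exists w; split=> //; have [chi0|chi0] := eqVneq chi 0; first by rewrite Xw chi0 scale0r.
pose E v := W v /\ X v = chi%:P *: v.
have sE : subspace E.
  split=> [|c v v' [Wv Xv] [Wv' Xv']].
    by split; [case: sW | rewrite (klinear0 lX) scaler0].
  by split; [case: sW => _; apply | rewrite lX Xv Xv' scalerDr !scalerA mulrC].
have EA : stable E A by move=> v [Wv Xv]; split; [exact: WA | rewrite -AX // Xv klinearZ].
have EB : stable E B by move=> v [Wv Xv]; split; [exact: WB | rewrite -BX // Xv klinearZ].
have dE : dim_le E r by apply: dim_leS dW => v [].
have AB' v : E v -> A (B v) = B (A v) + (0%:P *: B v + (k * chi)%:P *: v).
  by case=> Wv Xv; rewrite AB // Xv scale0r add0r scalerA polyCM.
have [v [Ev v0]] := commutator_kernel sE dE lA lB EA EB AB' (ex_intro2 _ _ w (conj Ww Xw) w0).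
rewrite scale0r add0r => E0; case: v0; rewrite -[v]scale1r -polyC1.
by rewrite -(mulVf (mulf_neq0 k0 chi0)) polyCM -scalerA E0 scaler0.
Qed.

End Operators.

(** * Consequences of sesquilinearity *)

Lemma poly_drop1 (R : nzRingType) (p : {poly R}) :
  p = drop_poly 1 p * 'X + (p`_0)%:P.
Proof.
by apply/polyP => -[|i]; rewrite coefD coefMX coefC /= ?add0r ?addr0 // coef_drop_poly addn1.
Qed.

Section Sesquilinear.
Variables (F : fieldType) (A V : lmodType {poly F}) (act : A -> V -> lpoly V).
Hypothesis sesq : sesquilinear act.
Implicit Types (x : A) (v : V) (p : {poly F}).

Lemma act0l v n : act 0 v n = 0.
Proof.
by have := sesqPl sesq (-1) 0 0 v n; rewrite scaler0 addr0 polyCN scaleN1r addNr.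
Qed.

Lemma actDl x y v n : act (x + y) v n = act x v n + act y v n.
Proof. by have := sesqPl sesq 1 x y v n; rewrite !scale1r. Qed.

Lemma actZl c x v n : act (c%:P *: x) v n = c%:P *: act x v n.
Proof. by have := sesqPl sesq c x 0 v n; rewrite act0l !addr0. Qed.

Lemma act0r x n : act x 0 n = 0.
Proof.
by have := sesqPr sesq (-1) x 0 0 n; rewrite scaler0 addr0 polyCN scaleN1r addNr.
Qed.

Lemma actDr x v w n : act x (v + w) n = act x v n + act x w n.
Proof. by have := sesqPr sesq 1 x v w n; rewrite !scale1r. Qed.

Lemma actZr c x v n : act x (c%:P *: v) n = c%:P *: act x v n.
Proof. by have := sesqPr sesq c x v 0 n; rewrite act0r !addr0. Qed.

Lemma actNr x v n : act x (- v) n = - act x v n.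
Proof. by have := actZr (-1) x v n; rewrite polyCN !scaleN1r. Qed.

Lemma act_polyl x v c p n :
  act ((p * 'X + c%:P) *: x) v n =
  - lambda_mul (act (p *: x) v) n + c%:P *: act x v n.
Proof. by rewrite scalerDl actDl actZl mulrC -scalerA (sesqXl sesq). Qed.

Lemma act_polyr x v c p n :
  act x ((p * 'X + c%:P) *: v) n =
  'X *: act x (p *: v) n + lambda_mul (act x (p *: v)) n + c%:P *: act x v n.
Proof. by rewrite scalerDl actDr actZr mulrC -scalerA (sesqXr sesq). Qed.

Lemma act_bounded x v : exists N, forall n, (N <= n)%N -> act x v n = 0.
Proof.
exists (\max_(k <- finsupp (act x v)) k).+1 => n ltn; apply/eqP.
rewrite -memNfinsupp; apply: contraL ltn => nin; rewrite -ltnNge ltnS.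
by rewrite (big_fsetD1 n) //= leq_maxl.
Qed.

(** Since (p(∂) x)_λ = p(-λ) x_λ, the coefficient at n involves only x[k] with n - d <= k <= n. *)
Lemma act_scale_eq0 d p x v n : (size p <= d.+1)%N ->
  (forall k, (n <= k + d)%N -> act x v k = 0) -> act (p *: x) v n = 0.
Proof.
elim: d p n => [|d IH] p n szp x0.
  by rewrite (size1_polyC szp) actZl x0 ?addn0 // scaler0.
rewrite (poly_drop1 p) act_polyl x0 ?leq_addr // scaler0 addr0.
case: n x0 => [|n] x0 /=; first by rewrite oppr0.
rewrite IH ?oppr0 ?size_drop_poly ?leq_subLR // => k le; apply: x0.
by rewrite addnS ltnS.
Qed.

(** The sign comes from the top coefficient of p(-λ). *)
Lemma act_scale_top d p x v n : (size p <= d.+1)%N ->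
  (forall k, (n < k)%N -> act x v k = 0) ->
  act (p *: x) v (n + d)%N = ((-1) ^+ d * p`_d)%:P *: act x v n.
Proof.
elim: d p => [|d IH] p szp x0.
  by rewrite {1}(size1_polyC szp) actZl addn0 expr0 mul1r.
rewrite {1}(poly_drop1 p) act_polyl x0 ?addnS ?ltnS ?leq_addr // scaler0 addr0 /=.
rewrite IH ?size_drop_poly ?leq_subLR // coef_drop_poly addn1 exprS mulN1r mulNr.
by rewrite polyCN scaleNr.
Qed.

Lemma act_poly_eq0 d p x v n : (size p <= d.+1)%N ->
  (forall k, (n <= k + d)%N -> act x v k = 0) -> act x (p *: v) n = 0.
Proof.
elim: d p n => [|d IH] p n szp x0.
  by rewrite (size1_polyC szp) actZr x0 ?addn0 // scaler0.
have szq : (size (drop_poly 1 p) <= d.+1)%N by rewrite size_drop_poly leq_subLR.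
rewrite (poly_drop1 p) act_polyr x0 ?leq_addr // scaler0 addr0 IH //; last first.
  by move=> k le; apply: x0; rewrite addnS leqW.
rewrite scaler0 add0r; case: n x0 => //= n x0; rewrite IH // => k le.
by apply: x0; rewrite addnS ltnS.
Qed.

(** In x_λ (p(∂) v) = p(∂ + λ) x_λ v the coefficient of λ^d in p(∂ + λ) is a scalar, so ∂ does not
    enter the top term. *)
Lemma act_poly_top d p x v n : (size p <= d.+1)%N ->
  (forall k, (n < k)%N -> act x v k = 0) ->
  act x (p *: v) (n + d)%N = (p`_d)%:P *: act x v n.
Proof.
elim: d p => [|d IH] p szp x0.
  by rewrite {1}(size1_polyC szp) actZr addn0.
have szq : (size (drop_poly 1 p) <= d.+1)%N by rewrite size_drop_poly leq_subLR.
rewrite {1}(poly_drop1 p) act_polyr x0 ?addnS ?ltnS ?leq_addr // scaler0 addr0 /=.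
rewrite (act_poly_eq0 (d := d)) // => [|k]; last first.
  by rewrite -addSn leq_add2r; apply: x0.
by rewrite scaler0 add0r IH // coef_drop_poly addn1.
Qed.

Lemma act_closed (U : V -> Prop) x v p q n :
  U 0 -> (forall r u w, U u -> U w -> U (r *: u + w)) ->
  (forall k, U (act x v k)) -> U (act (q *: x) (p *: v) n).
Proof.
move=> U0 UP Ux; have UD u w : U u -> U w -> U (u + w).
  by move=> *; rewrite -[u]scale1r; apply: UP.
have UZ r u : U u -> U (r *: u) by move=> Uu; rewrite -[_ *: _]addr0; apply: UP.
have UL (u : lpoly V) k : (forall i, U (u i)) -> U (lambda_mul u k).
  by case: k => [|k] Uu //=.
elim/poly_ind: q n => [|q c IH] n.
  by rewrite scale0r act0l.
rewrite act_polyl; apply/UD; first by rewrite -scaleN1r; apply/UZ/UL.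
apply/UZ => {IH}; elim/poly_ind: p n => [|p c' IH] n.
  by rewrite scale0r act0r.
by rewrite act_polyr; apply/UD/UZ => //; apply/UD/UL => //; apply/UZ.
Qed.

End Sesquilinear.

Lemma sesquilinear_intertwine (F : fieldType) (A V W : lmodType {poly F})
    (actV : A -> V -> lpoly V) (actW : A -> W -> lpoly W) (g : {linear W -> V}) x w :
  sesquilinear actV -> sesquilinear actW ->
  (forall n, g (actW x w n) = actV x (g w) n) ->
  forall p q n, g (actW (q *: x) (p *: w) n) = actV (q *: x) (g (p *: w)) n.
Proof.
move=> sV sW gx p q.
have gL (u : lpoly W) (u' : lpoly V) k : (forall i, g (u i) = u' i) ->
    g (lambda_mul u k) = lambda_mul u' k.
  by case: k => [|k] gu //=; rewrite linear0.
have gp n : g (actW x (p *: w) n) = actV x (g (p *: w)) n.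
  elim/poly_ind: p n => [|p c IH] n.
    by rewrite scale0r linear0 (act0r sW) (act0r sV) linear0.
  rewrite (act_polyr sW) [in RHS]linearZ (act_polyr sV) !linearD !linearZ /= gx.
  by rewrite IH linearZ; congr (_ + _ + _); apply/gL => i; rewrite IH linearZ.
elim/poly_ind: q => [|q c IH] n.
  by rewrite scale0r (act0l sW) (act0l sV) linear0.
rewrite (act_polyl sW) (act_polyl sV) linearD linearN linearZ /= gp.
by congr (- _ + _); apply/gL.
Qed.

(** * Commutators with L[n], for brackets [L_λ x] = (∂ + pλ + b) x *)

Definition primary (F : fieldType) (A : lieConformalAlgebra F) (eL x : A) (p b : F) :=
  [/\ lca_bracket eL x 0%N = ('X + b%:P) *: x, lca_bracket eL x 1%N = p%:P *: x &
      forall n, lca_bracket eL x n.+2 = 0].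

(* The common shape of TSV(a, b) and TSV(c): [Y_λ Y] = (∂ + 2λ) s(∂) M with   *)
(* s = 1 and s = - ∂ - 2c respectively.                                        *)
Record tsv_brackets (F : fieldType) (A : lieConformalAlgebra F) (eL eY eM : A)
    (p b q b' : F) (s : {poly F}) : Prop := {
  tsv_span : forall x, exists f g h : {poly F}, x = f *: eL + g *: eY + h *: eM;
  tsv_LL : primary eL eL 2 0;
  tsv_LY : primary eL eY p b;
  tsv_LM : primary eL eM q b';
  tsv_YY0 : lca_bracket eY eY 0%N = ('X * s) *: eM;
  tsv_YY1 : lca_bracket eY eY 1%N = (s *+ 2) *: eM;
  tsv_YYn : forall n, lca_bracket eY eY n.+2 = 0;
  tsv_YM : forall n, lca_bracket eY eM n = 0;
  tsv_MM : forall n, lca_bracket eM eM n = 0 }.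

Section Primary.
Variables (F : fieldType) (A : lieConformalAlgebra F) (V : conformalModule A).
Implicit Types (x y : A) (v : V).
Local Notation act := (@cm_act F A V).

Lemma act_klinear x n c v w :
  act x (c%:P *: v + w) n = c%:P *: act x v n + act x w n.
Proof. exact: (sesqPr (@cm_sesquilinear F A V)). Qed.

Lemma act_commute x y v m n : (forall k, lca_bracket x y k = 0) ->
  act x (act y v n) m = act y (act x v m) n.
Proof.
move=> xy; apply/eqP; rewrite -subr_eq0 (cm_jacobi x y v m n); apply/eqP.
by rewrite big1 // => i _; rewrite xy (act0l (@cm_sesquilinear F A V)) mul0rn.
Qed.

Variables (eL : A).

(** The commutator [L[m+1], x[n]] is read off from [L_λ x]_{λ+μ} = (- (λ + μ) + pλ + b) x_{λ+μ}. *)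
Lemma act_L_primary x p b v m n : primary eL x p b ->
  act eL (act x v n) m.+1 = act x (act eL v m.+1) n +
    ((b *+ 'C(m.+1 + n, n))%:P *: act x v (m.+1 + n)%N +
     (p *+ 'C(m + n, n) - 'C(m.+1 + n, n)%:R)%:P *: act x v (m + n)%N).
Proof.
have sV := @cm_sesquilinear F A V.
case=> x0 x1 xn; apply/eqP; rewrite addrC -subr_eq; apply/eqP.
rewrite (cm_jacobi eL x v m.+1 n) !big_ord_recl /= big1 ?addr0 => [|i _]; last first.
  by rewrite /bump /= xn (act0l sV) mul0rn.
rewrite subn0 /bump /= addn0 subn1 /= x0 x1 (actZl sV) scalerDl (actDl sV) (actZl sV).
rewrite (sesqXl sV) /= polyCB scalerBl !(rmorphMn polyC) /= -!scalerMnl.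
by rewrite scale1r mulrnDl mulNrn -addrA addrCA [- _ + _]addrC.
Qed.

(** That is, [T, x[n]] = b x[n]: the term - μ x_μ of [L[0], x_μ] cancels against [∂, x_μ]. *)
Lemma act_T_primary x p b v n : primary eL x p b ->
  act eL (act x v n) 0 - 'X *: act x v n =
  act x (act eL v 0 - 'X *: v) n + b%:P *: act x v n.
Proof.
have sV := @cm_sesquilinear F A V.
case=> x0 x1 xn; have := cm_jacobi eL x v 0 n.
rewrite big_ord1 subn0 add0n binn mulr1n x0 scalerDl (actDl sV) (actZl sV).
rewrite (sesqXl sV) => /eqP; rewrite subr_eq => /eqP ->.
rewrite (actDr sV) (actNr sV) (sesqXr sV) opprD -!addrA [LHS]addrCA [in LHS]addrA.
by rewrite [LHS]addrC [b%:P *: _ - _]addrC -addrA.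
Qed.
End Primary.

(** * Layers of vectors killed beyond given thresholds, and the joint eigenvector *)

Section Filtration.
Variables (F : numClosedFieldType) (A : lieConformalAlgebra F) (V : conformalModule A).
Variables (eL eY eM : A) (p b q b' : F) (s : {poly F}).
Hypotheses (AB : tsv_brackets eL eY eM p b q b' s) (s0 : s != 0).
Implicit Types (v w u : V) (l y m n N d : nat).
Local Notation act := (@cm_act F A V).
Local Notation L n := (fun v : V => act eL v n).
Local Notation Y n := (fun v : V => act eY v n).
Local Notation M n := (fun v : V => act eM v n).
(* T = L[0] - ∂ commutes with all L[n] *)
Local Notation T := (fun v : V => act eL v 0%N - 'X *: v).
Local Notation ds := (size s).-1.
Let sV := @cm_sesquilinear F A V.

Definition killed l y m v :=
  [/\ forall n, (l <= n)%N -> act eL v n = 0,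
      forall n, (y <= n)%N -> act eY v n = 0 &
      forall n, (m <= n)%N -> act eM v n = 0].

Definition nonzero_in (W : V -> Prop) := exists2 w, W w & w <> 0.

Lemma killed_subspace l y m : subspace (killed l y m).
Proof.
split=> [|c u w [Lu Yu Mu] [Lw Yw Mw]]; first by split=> n _; rewrite (act0r sV).
by split=> n le; rewrite act_klinear ?(Lu, Lw, Yu, Yw, Mu, Mw) // scaler0 addr0.
Qed.

Lemma klinearT : klinear T.
Proof.
move=> c u w; rewrite act_klinear scalerDr scalerBr opprD addrACA; congr (_ - _ + _).
by rewrite !scalerA mulrC.
Qed.

(** [L[j+1], x[n]] involves only x[j+n] and x[j+1+n], whose indices are at least n. L[0] would bring
    in x[n-1], which is why T takes its place. *)
Lemma killed_L l y m j : stable (killed l y m) (L j.+1).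
Proof.
have kill x t c e v : primary eL x c e -> (forall n, (t <= n)%N -> act x v n = 0) ->
    (forall n, (t <= n)%N -> act x (act eL v j.+1) n = 0).
  move=> xP x0 n le; have := act_L_primary v j n xP.
  have le1 : (t <= j + n)%N by lia.
  have le2 : (t <= j.+1 + n)%N by lia.
  by rewrite (x0 _ le) (x0 _ le1) (x0 _ le2) (act0r sV) !scaler0 !addr0 => <-.
case: AB => _ LL LY LM _ _ _ _ _ v [Lv Yv Mv].
by split; apply: kill; eassumption.
Qed.

Lemma killed_T l y m : stable (killed l y m) T.
Proof.
have kill x t c e v : primary eL x c e -> (forall n, (t <= n)%N -> act x v n = 0) ->
    (forall n, (t <= n)%N -> act x (T v) n = 0).
  move=> xP x0 n le; have := act_T_primary v n xP.
  by rewrite !x0 // (act0r sV) !scaler0 subrr addr0 => <-.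
case: AB => _ LL LY LM _ _ _ _ _ v [Lv Yv Mv].
by split; apply: kill; eassumption.
Qed.

Lemma killed_M l y m j : (m < l)%N -> stable (killed l y m) (M j).
Proof.
case: AB => _ LL LY LM _ _ _ YM MM ml v [Lv Yv Mv]; split=> n le.
- case: n le => [|n] le; first by lia.
  by rewrite (act_L_primary v n j LM) Lv // (act0r sV) !Mv ?scaler0 ?addr0 //; lia.
- by rewrite (act_commute v n j YM) Yv // (act0r sV).
- by rewrite (act_commute v n j MM) Mv // (act0r sV).
Qed.

Lemma act_YY v m n :
  act eY (act eY v n) m = act eY (act eY v m) n +
    (act (('X * s) *: eM) v (m + n)%N *+ 'C(m + n, n) +
    if m is m'.+1 then act ((s *+ 2) *: eM) v (m' + n)%N *+ 'C(m' + n, n) else 0).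
Proof.
case: AB => _ _ _ _ YY0 YY1 YYn _ _.
apply/eqP; rewrite addrC -subr_eq; apply/eqP; rewrite cm_jacobi.
rewrite big_ord_recl subn0 YY0; case: m => [|m]; first by rewrite big_ord0.
rewrite big_ord_recl /bump /= subn1 YY1 big1 ?addr0 // => i _.
by rewrite YYn (act0l sV) mul0rn.
Qed.

(** ∂ s(∂) has degree [ds.+1], so [Y[m], Y[n]] involves only M[k] with k >= m + n - [ds.+1]. *)
Lemma YY_eq0 v m n :
  (forall k, (m + n <= k + ds.+1)%N -> act eM v k = 0) ->
  act eY (act eY v n) m = act eY (act eY v m) n.
Proof.
move=> M0; rewrite act_YY (act_scale_eq0 sV (d := ds.+1)) //; last first.
  by rewrite mulrC size_mulX // ltnS leqSpred.
rewrite mul0rn add0r; case: m M0 => [|m] M0; first by rewrite addr0.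
rewrite mulr2n scalerDl (actDl sV) (act_scale_eq0 sV (d := ds)).
- by rewrite addr0 mul0rn addr0.
- exact: leqSpred.
- by move=> k le; apply: M0; lia.
Qed.

(** Here [Y_λ Y]_{λ+μ} = (λ - μ) s(- λ - μ) M_{λ+μ}. At μ = 0 this is λ s(-λ) M_λ, whose top
    coefficient is displayed. *)
Lemma YY_top v n : (forall k, (n < k)%N -> act eM v k = 0) ->
  act eY (act eY v 0) (n + ds).+1 =
  act eY (act eY v (n + ds).+1) 0 + ((-1) ^+ ds * lead_coef s)%:P *: act eM v n.
Proof.
move=> M0; rewrite act_YY !addn0 !bin0 !mulr1n -scalerA (sesqXl sV) /=.
by rewrite mulr2n scalerDl (actDl sV) addKr (act_scale_top sV) // leqSpred.
Qed.

(** The first condition keeps [L[n], Y[j]] with n >= l among Y-indices at least y; the second keeps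
    [Y[n], Y[j]] with n >= y among M-indices at least m. *)
Lemma killed_Y l y m j : (y < l)%N -> (m <= y - ds.+1)%N -> stable (killed l y m) (Y j).
Proof.
case: AB => _ LL LY LM _ _ _ YM MM yl my v [Lv Yv Mv]; split=> n le.
- case: n le => [|n] le; first by lia.
  by rewrite (act_L_primary v n j LY) Lv // (act0r sV) !Yv ?scaler0 ?addr0 //; lia.
- by rewrite YY_eq0 ?Yv ?(act0r sV) // => k le'; apply: Mv; lia.
- by rewrite -(act_commute v j n YM) Mv // (act0r sV).
Qed.

Lemma vanish_from (f : nat -> V) t : (forall n, (t < n)%N -> f n = 0) -> f t = 0 ->
  forall n, (t <= n)%N -> f n = 0.
Proof. by move=> f0 ft n; rewrite leq_eqVlt => /orP[/eqP <-|/f0]. Qed.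

Lemma killed_sub l y m l' y' m' v : (l' <= l)%N -> (y' <= y)%N -> (m' <= m)%N ->
  killed l' y' m' v -> killed l y m v.
Proof.
by move=> lel ley lem [Lv Yv Mv]; split=> n le;
  [apply: Lv | apply: Yv | apply: Mv]; apply: leq_trans le.
Qed.

Lemma klinear_act (x : A) n : klinear (fun v : V => act x v n).
Proof. by move=> c u w; apply: act_klinear. Qed.

(* [Y[m+d+1], Y[0]] is a nonzero multiple of M[m] modulo higher M[n], d = deg s. *)
Lemma kill_M l y m r : (y < l)%N -> (m <= y - ds.+1)%N ->
  dim_le (killed l y m) r -> nonzero_in (killed l y m) -> nonzero_in (killed l y 0).
Proof.
have [_ _ _ _ _ _ _ YM _] := AB.
move=> yl; elim: m => // m IH my dW neW.
have WY j := @killed_Y l y m.+1 j yl my.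
have WM : stable (killed l y m.+1) (M m) by apply: killed_M; lia.
have k0 : (-1) ^+ ds * lead_coef s != 0 by rewrite mulf_neq0 ?lead_coef_eq0 ?signr_eq0.
have [|||v [[Lv Yv Mv] v0 Mmv]] := heisenberg_kernel (killed_subspace l y m.+1) dW
  (klinear_act eY (m + ds).+1) (klinear_act eY 0%N) (klinear_act eM m)
  (WY _) (WY _) WM k0 _ _ _ neW.
- by move=> w [_ _ Mw]; apply: YY_top.
- by move=> w _; apply: act_commute.
- by move=> w _; apply: act_commute.
apply: IH; first by lia.
  by apply: dim_leS dW => w; apply: killed_sub.
by exists v => //; split=> //; apply: vanish_from.
Qed.

(** The highest surviving Y[n] is removed by T if b <> 0, by L[1] if p <> n + 1, and otherwise, for
    n > 0, as a multiple of [L[2], Y[n-1]]. Only Y[0] with p = 1 and b = 0 resists. *)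
Lemma kill_Y l y r : (y < l)%N -> dim_le (killed l y 0) r ->
  nonzero_in (killed l y 0) ->
  exists y', [/\ (y' <= y)%N, nonzero_in (killed l y' 0) &
    y' = 0%N \/ [/\ y' = 1%N, (1 < l)%N, p = 1 & b = 0]].
Proof.
have [_ _ LY _ _ _ _ _ _] := AB.
elim: y => [|y IH] yl dW neW; first by exists 0%N; split=> //; left.
have WY j : stable (killed l y.+1 0) (Y j) by apply: killed_Y.
have WL j := @killed_L l y.+1 0 j.
have WT := @killed_T l y.+1 0.
have sW := killed_subspace l y.+1 0.
suff: nonzero_in (fun v => killed l y.+1 0 v /\ act eY v y = 0) \/
    [/\ y = 0%N, p = 1 & b = 0].
  case=> [[v [[Lv Yv Mv] Yyv] v0]|[y0 p1 b0]]; last first.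
    by exists y.+1; split=> //; right; rewrite y0 in yl *.
  have [||y' [le ne H]] := IH (ltnW yl).
  - by apply: dim_leS dW => w; apply: killed_sub.
  - by exists v => //; split=> //; apply: vanish_from.
  by exists y'; split=> //; apply: leqW.
have pack : (exists v, [/\ killed l y.+1 0 v, v <> 0 & act eY v y = 0]) ->
    nonzero_in (fun v => killed l y.+1 0 v /\ act eY v y = 0).
  by case=> v [Wv v0 Yv]; exists v.
have [b0|b0] := eqVneq b 0; last first.
  left; apply/pack/(nilpotent_kernel sW dW klinearT (klinear_act eY y) WT (WY y) b0) => //.
  by move=> w _; exact: act_T_primary LY.
(* [L[1], Y[y]] = (p - y - 1) Y[y] once Y[y+1] = 0. *)
have [py|py] := eqVneq p y.+1%:R; last first.
  have k0 : p - y.+1%:R != 0 by rewrite subr_eq0.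
  left; apply/pack/(nilpotent_kernel sW dW (klinear_act eL 1%N) (klinear_act eY y)
    (WL 0%N) (WY y) k0) => //.
  move=> w _; rewrite (act_L_primary _ _ _ LY) b0 mul0rn scale0r add0r.
  by rewrite add0n binn mulr1n add1n binSn.
case: y py IH yl dW neW WY WL WT sW pack => [|z] py IH yl dW neW WY WL WT sW pack.
  by right.
(* Now [L[2], Y[z]] is a nonzero multiple of Y[z+1], which is central here. *)
have k0 : p *+ 'C(z.+1, z) - 'C(z.+2, z)%:R != 0.
  (* As p = z + 2, the first term is (z + 2)(z + 1) = 2 C(z+2, z), so the difference is C(z+2,
     z). *)
  rewrite py binSn -mulrnA subr_eq0 eqr_nat.
  have := mul_bin_left z.+2 z; rewrite binSn (_ : z.+2 - z = 2)%N; last by lia.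
  have : (0 < 'C(z.+2, z))%N by rewrite bin_gt0; lia.
  by move=> C0 E; apply/eqP => E2; move: E; rewrite mulnC E2; lia.
left; apply/pack/(heisenberg_kernel sW dW (klinear_act eL 2%N) (klinear_act eY z)
  (klinear_act eY z.+1) (WL 1%N) (WY z) (WY z.+1) k0) => //.
- move=> w _; rewrite (act_L_primary _ _ _ LY) b0 mul0rn scale0r add0r.
  by rewrite add1n add2n.
- move=> w [_ Yw _]; rewrite (act_L_primary _ _ _ LY) !Yw ?scaler0 ?addr0 //; lia.
- by move=> w [_ _ Mw]; apply: YY_eq0 => k _; apply: Mw.
Qed.

(** [L[1], L[n]] = (1 - n) L[n] removes every L[n] with n >= 2, from the top down. *)
Lemma kill_L l y r : dim_le (killed l y 0) r ->
  nonzero_in (killed l y 0) -> nonzero_in (killed (minn l 2) y 0).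
Proof.
have [_ LL _ _ _ _ _ _ _] := AB.
elim: l => [|[|[|l]] IH] dW neW //.
have WL j := @killed_L l.+3 y 0 j.
have k0 : 2 - l.+3%:R != 0 :> F by rewrite subr_eq0 eqr_nat.
have [|v [[Lv Yv Mv] v0 Llv]] := nilpotent_kernel (killed_subspace _ _ _) dW
  (klinear_act eL 1%N) (klinear_act eL l.+2) (WL 0%N) (WL l.+1) k0 _ neW.
  move=> w _; rewrite (act_L_primary _ _ _ LL) mul0rn scale0r add0r.
  by rewrite add0n binn mulr1n add1n binSn.
rewrite (_ : minn _ _ = minn l.+2 2) //.
apply: IH; first by apply: dim_leS dW => w; apply: killed_sub.
by exists v => //; split=> //; apply: vanish_from.
Qed.

(** Y[0], T and L[1] are treated in turn, each on the eigenspace of the previous ones. That of Y[0]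
    is stable because [T, Y[0]] = b Y[0] and [L[1], Y[0]] = (p - 1) Y[0] vanish on it, whether gamma
    = 0 or p = 1 and b = 0; and T commutes with L[1]. *)
Lemma joint_eigenvector l y r : dim_le (killed l y 0) r ->
  nonzero_in (killed l y 0) ->
  y = 0%N \/ [/\ y = 1%N, (1 < l)%N, p = 1 & b = 0] ->
  exists v alpha beta gamma, [/\ v <> 0, killed l y 0 v,
    [/\ act eL v 0 = ('X + beta%:P) *: v, act eL v 1 = alpha%:P *: v &
        act eY v 0 = gamma%:P *: v] &
    gamma = 0 \/ p = 1 /\ b = 0].
Proof.
have [_ LL LY _ _ _ _ _ _] := AB.
move=> dW neW H; have sW := killed_subspace l y 0.
pose E gamma v := killed l y 0 v /\ act eY v 0 = gamma%:P *: v.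
have [gamma [gP [u Eu u0]]] : exists gamma, (gamma = 0 \/ p = 1 /\ b = 0) /\
    nonzero_in (E gamma).
  case: H => [y0|[y1 l1 p1 b0]].
    have [v Kv v0] := neW; have [_ Yv _] := Kv; exists 0; split; first by left.
    by exists v => //; split; rewrite // scale0r Yv ?y0.
  have [|rho [w [Ww w0 Yw]]] := eigenvector sW dW (klinear_act eY 0%N) _ neW.
    by apply: killed_Y; rewrite ?y1.
  by exists rho; split; [right | exists w].
have y1 : (y <= 1)%N by case: H => [->|[->]].
have bg : b%:P * gamma%:P = 0 :> {poly F}.
  by case: gP => [->|[_ ->]]; rewrite polyC0 ?mulr0 ?mul0r.
have pg : (p - 1)%:P * gamma%:P = 0 :> {poly F}.
  by case: gP => [->|[-> _]]; rewrite ?subrr polyC0 ?mulr0 ?mul0r.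
have sE : subspace (E gamma).
  split=> [|c v w [Wv Yv] [Ww Yw]].
    by split; [case: sW | rewrite (act0r sV) scaler0].
  split; first by case: sW => _; apply.
  by rewrite act_klinear Yv Yw scalerDr !scalerA mulrC.
have ET : stable (E gamma) T.
  move=> v [Wv Yv]; split; first exact: killed_T.
  have := act_T_primary v 0 LY; rewrite Yv (scalerA b%:P) bg scale0r addr0 => <-.
  by rewrite (actZr sV) scalerBr !scalerA [_ * 'X]mulrC.
have EL : stable (E gamma) (L 1%N).
  move=> v [Wv Yv]; split; first exact: killed_L.
  have [_ Y1 _] := Wv; have := act_L_primary v 0 0 LY.
  rewrite (Y1 (1 + 0)%N y1) scaler0 add0r !bin0 !mulr1n Yv scalerA pg scale0r addr0 => <-.
  by rewrite (actZr sV).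
have dE : dim_le (E gamma) r by apply: dim_leS dW => w [].
have [beta [w [Ew w0 Tw]]] := eigenvector sE dE klinearT ET (ex_intro2 _ _ u Eu u0).
pose E' v := E gamma v /\ T v = beta%:P *: v.
have sE' : subspace E'.
  split=> [|c v v' [Wv Yv] [Wv' Yv']].
    by split; [case: sE | rewrite (act0r sV) !scaler0 subrr].
  split; first by case: sE => _; apply.
  by rewrite klinearT Yv Yv' scalerDr !scalerA mulrC.
have EL' : stable E' (L 1%N).
  move=> v [Ev Tv]; split; first exact: EL.
  by rewrite (act_T_primary _ _ LL) Tv (actZr sV) scale0r addr0.
have dE' : dim_le E' r by apply: dim_leS dE => v [].
have [alpha [v [[[Wv Yv] Tv] v0 Lv]]] :=
  eigenvector sE' dE' (klinear_act eL 1%N) EL' (ex_intro2 _ _ w (conj Ew Tw) w0).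
exists v, alpha, beta, gamma; split=> //.
by split=> //; rewrite scalerDl -Tv addrC subrK.
Qed.

(* The shifts make every layer with N > 0 stable under L[n+1], Y[n] and M[n]. *)
Let Fil N := killed N N.-1 (N - ds.+2).

(** Induction on a degree bound D: the combination u of the f i with the coefficients of degree D is
    killed one index earlier than the f i, so it lies in [Fil N] and vanishes, and the bound
    drops. *)
Lemma poly_independent N k (f : 'I_k -> V) (g : 'I_k -> {poly F}) :
  (forall v, Fil N v -> v = 0) -> (forall i, Fil N.+1 (f i)) ->
  \sum_i g i *: f i = 0 -> forall j, \sum_i ((g i)`_j)%:P *: f i = 0.
Proof.
move=> F0 Ff; suff H D (h : 'I_k -> {poly F}) : (forall i, size (h i) <= D)%N ->
    \sum_i h i *: f i = 0 -> forall j, \sum_i ((h i)`_j)%:P *: f i = 0.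
  by apply: (H (\max_i size (g i))) => i; apply: (leq_bigmax i).
elim: D h => [|D IH] h szh h0 j.
  by rewrite big1 // => i _; rewrite nth_default ?scale0r // (leq_trans (szh i)).
pose u := \sum_i ((h i)`_D)%:P *: f i.
(* x[n] u is the coefficient of λ^(n+D) in x_λ applied to the relation. *)
have kill x n : (forall i m, (n < m)%N -> act x (f i) m = 0) -> act x u n = 0.
  move=> x0; rewrite /u (klinear_sum _ _ _ (klinear_act x n)).
  transitivity (act x (\sum_i h i *: f i) (n + D)%N); last by rewrite h0 (act0r sV).
  rewrite (big_morph (fun v : V => act x v (n + D)%N) (id1 := 0) (op1 := +%R)).
  - by apply: eq_bigr => i _; rewrite (act_poly_top sV) // => m; apply: x0.
  - by move=> v w; rewrite (actDr sV).
  - by rewrite (act0r sV).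
have u0 : u = 0.
  apply: F0; split=> n le; apply: kill => i m lt; have [Lf Yf Mf] := Ff i.
  - by apply: Lf; lia.
  - by apply: Yf; lia.
  - by apply: Mf; lia.
have hE i : h i = take_poly D (h i) + ((h i)`_D)%:P * 'X^D.
  apply/polyP => m; rewrite coefD coef_take_poly coefCM coefXn.
  case: (ltngtP m D) => [||->]; rewrite ?mulr0 ?mulr1 ?addr0 ?add0r // => ltm.
  by rewrite nth_default // (leq_trans (szh i)).
have szt : forall i, (size (take_poly D (h i)) <= D)%N by move=> i; apply: size_take_poly.
have t0 : \sum_i take_poly D (h i) *: f i = 0.
  apply: etrans h0; transitivity (\sum_i take_poly D (h i) *: f i + 'X^D *: u).
    by rewrite u0 scaler0 addr0.
  rewrite scaler_sumr -big_split.
  by apply: eq_bigr => i _; rewrite scalerA /= -scalerDl [_ * _%:P]mulrC -hE.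
have [ltj|lej] := ltnP j D.
  rewrite -[RHS](IH _ szt t0 j); apply: eq_bigr => i _.
  by rewrite coef_take_poly ltj.
have [->//|ne] := eqVneq j D.
by rewrite big1 // => i _; rewrite nth_default ?scale0r // (leq_trans (szh i)) //; lia.
Qed.

(** With r generators over C[∂], any r + 1 vectors satisfy a C[∂]-relation g. Its coefficients at
    the degree of some nonzero g i form a nontrivial C-relation. *)
Lemma Fil_dim N : cm_finite V -> (forall v, Fil N v -> v = 0) ->
  exists r, dim_le (Fil N.+1) r.
Proof.
case=> r [e gen] F0; exists r => f Ff.
have [c cP] := fin_all_exists (fun i => gen (f i)).
have [g [[i gi] g0]] := left_dependence c.
exists (fun k => (g k)`_(size (g i)).-1); split.
  by exists i; rewrite -lead_coefE lead_coef_eq0.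
apply: poly_independent (F0) Ff _ _.
under eq_bigr => k _ do rewrite cP scaler_sumr.
rewrite exchange_big big1 //= => j _; rewrite -[RHS](scale0r (e j)) -(g0 j) scaler_suml.
by apply: eq_bigr => k _; rewrite scalerA.
Qed.

Lemma act_killed v (x : A) n : killed 0 0 0 v -> act x v n = 0.
Proof.
case=> Lv Yv Mv; have [f [g [h ->]]] := tsv_span AB x.
have x0 (e : A) (c : {poly F}) : (forall k, act e v k = 0) -> act (c *: e) v n = 0.
  by move=> e0; rewrite (act_scale_eq0 sV (leqSpred _)).
by rewrite !(actDl sV) !x0 ?addr0 // => k; [apply: Mv | apply: Yv | apply: Lv].
Qed.

(** The vectors killed by the whole algebra form a submodule, which is all of V only if V is
    trivial. *)
Lemma killed_all_eq0 v : ~ cm_trivial V -> cm_irreducible V -> killed 0 0 0 v -> v = 0.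
Proof.
move=> ntV [_ irrV]; have [|v0|all] := irrV (killed 0 0 0).
- split=> [|f u w Wu Ww|x u n Wu].
  + by case: (killed_subspace 0 0 0).
  + split=> n _; rewrite (actDr sV) [X in _ + X]act_killed // addr0;
    rewrite (act_poly_eq0 sV (leqSpred _)) // => k _; exact: act_killed.
  + by rewrite act_killed //; case: (killed_subspace 0 0 0).
- exact: v0.
by case: ntV => x w n; apply: act_killed.
Qed.

Lemma Fil_min : ~ cm_trivial V -> cm_irreducible V ->
  exists N, nonzero_in (Fil N.+1) /\ forall v, Fil N v -> v = 0.
Proof.
move=> ntV irrV; have [[v v0] _] := irrV.
have [NL PL] := act_bounded (@cm_act F A V) eL v.
have [NY PY] := act_bounded (@cm_act F A V) eY v.
have [NM PM] := act_bounded (@cm_act F A V) eM v.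
have exN : exists N, `[< nonzero_in (Fil N) >].
  exists (NL + NY + NM + ds.+2)%N; apply/asboolP; exists v => //.
  by split=> n le; [apply: PL | apply: PY | apply: PM]; lia.
(* The minimum is not 0: truncated subtraction makes [Fil 0] equal to [killed 0 0 0]. *)
case: (ex_minnP exN) => -[|N] /asboolP neN minN.
  case: neN => w Ww []; apply: (killed_all_eq0 ntV irrV).
  by apply: killed_sub Ww.
exists N; split=> // w Ww; apply: contrapT => w0.
suff: (N < N)%N by rewrite ltnn.
by apply/minN/asboolP; exists w.
Qed.

Lemma generating_eigenvector : cm_finite V -> ~ cm_trivial V -> cm_irreducible V ->
  exists v alpha beta gamma, [/\ killed 2 1 0 v,
    forall f : {poly F}, f *: v = 0 -> f = 0,
    [/\ act eL v 0 = ('X + beta%:P) *: v, act eL v 1 = alpha%:P *: v &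
        act eY v 0 = gamma%:P *: v] &
    gamma = 0 \/ p = 1 /\ b = 0].
Proof.
move=> finV ntV irrV; have [N [neN F0]] := Fil_min ntV irrV.
have [r dN] := Fil_dim finV F0.
have NN : (N < N.+1)%N by [].
have NM : (N.+1 - ds.+2 <= N - ds.+1)%N by [].
have dNY : dim_le (killed N.+1 N 0) r.
  by apply: dim_leS dN => v; apply: killed_sub.
have neW : nonzero_in (killed N.+1 N 0) := kill_M NN NM dN neN.
have [y [yN neY H]] := kill_Y NN dNY neW.
have dY : dim_le (killed N.+1 y 0) r by apply: dim_leS dNY => v; apply: killed_sub.
have dL : dim_le (killed (minn N.+1 2) y 0) r.
  by apply: dim_leS dY => v; apply: killed_sub => //; apply: geq_minl.
have [|v [alpha [beta [gamma [v0 Kv vE gP]]]]] := joint_eigenvector dL (kill_L dY neY).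
  by case: H => [->|[-> N1 p1 b0]]; [left | right; rewrite leq_min N1].
have y1 : (y <= 1)%N by case: H => [->|[->]].
exists v, alpha, beta, gamma; split=> //.
  by apply: killed_sub Kv => //; apply: geq_minr.
(* The vector v lies in [Fil N.+1], so [poly_independent] for this single vector shows that it has
   no torsion. *)
move=> f fv0; apply/polyP => j; rewrite coef0; apply/eqP/negP => /negP fj; case: v0.
have Fv (_ : 'I_1) : Fil N.+1 v.
  by apply: killed_sub Kv => //; apply: geq_minl.
have fv : \sum_(i < 1) f *: v = 0 by rewrite big_ord1.
have := poly_independent F0 Fv fv j; rewrite big_ord1 => fjv.
by rewrite -[v]scale1r -polyC1 -(mulVf fj) polyCM -scalerA fjv scaler0.
Qed.

End Filtration.

(** * Submodules and isomorphisms checked on generators *)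

Section Generators.
Variables (F : fieldType) (A : lieConformalAlgebra F) (eL eY eM : A).
Hypothesis span : forall x, exists f g h : {poly F}, x = f *: eL + g *: eY + h *: eM.
Implicit Types V W : conformalModule A.

Definition free_generator V (v : V) := forall u : V, exists! f : {poly F}, u = f *: v.

Lemma cm_submodule_act V (U : V -> Prop) (v : V) :
  U 0 -> (forall r u w, U u -> U w -> U (r *: u + w)) ->
  (forall n, U (cm_act eL v n)) -> (forall n, U (cm_act eY v n)) ->
  (forall n, U (cm_act eM v n)) -> forall x f n, U (cm_act x (f *: v) n).
Proof.
have sV := @cm_sesquilinear F A V.
move=> U0 UP UL UY UM x f n; have [g [h [k ->]]] := span x.
have UD u w : U u -> U w -> U (u + w) by move=> *; rewrite -[u]scale1r; apply/UP.
have Ue e l : (forall m, U (cm_act e v m)) -> U (cm_act (l *: e) (f *: v) n).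
  by move=> Ue; apply: (act_closed sV).
by rewrite !(actDl sV); apply/UD/Ue => //; apply/UD; apply/Ue.
Qed.

Lemma cm_iso_generators V W (v : V) (w : W) : free_generator v -> free_generator w ->
  (forall e, [\/ e = eL, e = eY | e = eM] -> forall n, exists2 f : {poly F},
     cm_act e v n = f *: v & cm_act e w n = f *: w) ->
  cm_iso V W.
Proof.
have [sV sW] := (@cm_sesquilinear F A V, @cm_sesquilinear F A W).
move=> fv fw act_vw.
have coord (Z : conformalModule A) (z : Z) : free_generator z ->
    exists c : Z -> {poly F}, (forall u, u = c u *: z) /\ forall f, c (f *: z) = f.
  move=> fz; have [c cP] := choice (fun u => let: ex_intro f (conj uf _) := fz u in
    ex_intro (fun f => u = f *: z) f uf).
  exists c; split=> // f; have [g [_ gu]] := fz (f *: z).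
  by rewrite -(gu _ (cP _)) -(gu f).
have [cv [cvE cvK]] := coord V v fv; have [cw [cwE cwK]] := coord W w fw.
pose phi u := cv u *: w.
have phiE f : phi (f *: v) = f *: w by rewrite /phi cvK.
have lin : linear phi.
  move=> r u u'; rewrite [u]cvE [u']cvE scalerA -scalerDl !phiE.
  by rewrite scalerDl scalerA.
pose psi : {linear V -> W} := HB.pack phi (GRing.isLinear.Build _ _ _ _ phi lin).
exists psi; split.
  exists (fun u => cw u *: v) => u; first by rewrite [u]cvE /= phiE cwK.
  by rewrite /= phiE -cwE.
have psie e f g n : [\/ e = eL, e = eY | e = eM] ->
    psi (cm_act (g *: e) (f *: v) n) = cm_act (g *: e) (psi (f *: v)) n.
  move=> eP; apply: (sesquilinear_intertwine sW sV) => m.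
  have [h vE wE] := act_vw e eP m.
  by rewrite vE /= phiE -[v]scale1r phiE !scale1r wE.
move=> x u n; have [f [g [h ->]]] := span x; rewrite [u]cvE.
rewrite !(actDl sV) !(actDl sW) !linearD !psie //; first by constructor 3.
  by constructor 2.
by constructor 1.
Qed.

(** The action on the generator of M_{alpha,beta,gamma}, or of M_{alpha,beta} when gamma = 0. *)
Definition rank1_generator V (v : V) (alpha beta gamma : F) :=
  [/\ free_generator v,
     [/\ cm_act eL v 0 = ('X + beta%:P) *: v, cm_act eL v 1 = alpha%:P *: v &
         forall n, cm_act eL v n.+2 = 0],
     cm_act eY v 0 = gamma%:P *: v /\ forall n, cm_act eY v n.+1 = 0 &
     forall n, cm_act eM v n = 0].

End Generators.

(** * Irreducible modules are free of rank one *)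

Section RankOne.
Variables (F : numClosedFieldType) (A : lieConformalAlgebra F) (V : conformalModule A).
Variables (eL eY eM : A) (p b q b' : F) (s : {poly F}).
Hypotheses (AB : tsv_brackets eL eY eM p b q b' s) (s0 : s != 0).

Lemma rank1_generator_ex : cm_finite V -> ~ cm_trivial V -> cm_irreducible V ->
  exists (v : V) alpha beta gamma, [/\ rank1_generator eL eY eM v alpha beta gamma,
    alpha <> 0 \/ gamma <> 0 & gamma = 0 \/ p = 1 /\ b = 0].
Proof.
move=> finV ntV irrV; have sV := @cm_sesquilinear F A V.
have [v [alpha [beta [gamma [[Lv Yv Mv] tf [L0 L1 Y0] gP]]]]] :=
  generating_eigenvector AB s0 finV ntV irrV.
have [_ irr] := irrV; have span := tsv_span AB.
have v0 : v <> 0.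
  by move=> v0; have /eqP := oner_neq0 {poly F}; apply; apply: tf; rewrite v0 scaler0.
pose U (w u : V) := exists f : {poly F}, u = f *: w.
have U0 w : U w 0 by exists 0; rewrite scale0r.
have UP w r u u' : U w u -> U w u' -> U w (r *: u + u').
  by case=> f -> [g ->]; exists (r * f + g); rewrite scalerA -scalerDl.
have Usub w : (forall n, U w (cm_act eL w n)) -> (forall n, U w (cm_act eY w n)) ->
    (forall n, U w (cm_act eM w n)) -> cm_submodule (U w).
  move=> UL UY UM; split; [exact: U0 | exact: UP | move=> x u n [f ->]].
  exact: (cm_submodule_act span (U0 w) (UP w) UL UY UM).
have Uv : cm_submodule (U v).
  apply: Usub => [[|[|n]]|[|n]|n]; rewrite ?L0 ?L1 ?Y0 ?Lv ?Yv ?Mv //;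
    by [exact: U0 | eexists].
have gen u : U v u.
  case: (irr _ Uv) => // U0v; case: v0; apply: U0v.
  by exists 1; rewrite scale1r.
exists v, alpha, beta, gamma; split=> //.
  split; [|by split=> // n; apply: Lv|by split=> // n; apply: Yv|by move=> n; apply: Mv].
  move=> u; have [f uE] := gen u; exists f; split=> // g; rewrite uE => /eqP.
  by rewrite -subr_eq0 -scalerBl => /eqP/tf/eqP; rewrite subr_eq0 => /eqP.
have [a0|a0] := eqVneq alpha 0; last by left; apply/eqP.
have [g0|g0] := eqVneq gamma 0; last by right; apply/eqP.
(* Now alpha = gamma = 0, so L_λ w = (∂ + λ + β) w while Y and M kill w: the multiples of w form a
   submodule. *)
pose w := ('X + beta%:P) *: v.
have actw e n : cm_act e w n =
    'X *: cm_act e v n + lambda_mul (cm_act e v) n + beta%:P *: cm_act e v n.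
  by rewrite /w scalerDl (actDr sV) (actZr sV) (sesqXr sV).
have Y0v n : cm_act eY v n = 0 by case: n => [|n]; rewrite ?Y0 ?g0 ?scale0r // Yv.
have Uw : cm_submodule (U w).
  apply: Usub => n; rewrite actw.
  - case: n => [|[|[|n]]] /=; rewrite ?L0 ?L1 ?Lv // ?a0 ?scale0r ?scaler0 ?add0r ?addr0 //.
    + by rewrite -scalerDl; eexists.
    + by exists 1; rewrite scale1r.
  - by case: n => [|n] /=; rewrite !Y0v !scaler0 !addr0.
  - by case: n => [|n] /=; rewrite !Mv // !scaler0 !addr0.
case: (irr _ Uw) => [w0|/(_ v)[f vE]].
  have /tf/eqP : w = 0 by apply: w0; exists 1; rewrite scale1r.
  by rewrite -size_poly_eq0 size_XaddC.
have /tf/eqP : (1 - f * ('X + beta%:P)) *: v = 0.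
  by rewrite scalerBl -scalerA scale1r -/w -vE subrr.
(* Evaluating 1 = f (∂ + β) at ∂ = - β gives 1 = 0. *)
rewrite subr_eq0 => /eqP/(congr1 (fun g : {poly F} => g.[- beta])).
by rewrite !hornerE addNr mulr0 => /eqP; rewrite oner_eq0.
Qed.

End RankOne.

Lemma rank1_generator_iso (F : fieldType) (A : lieConformalAlgebra F)
    (eL eY eM : A) (p b q b' : F) (s : {poly F}) (V W : conformalModule A)
    (v : V) (w : W) alpha beta gamma :
  tsv_brackets eL eY eM p b q b' s ->
  rank1_generator eL eY eM v alpha beta gamma ->
  rank1_generator eL eY eM w alpha beta gamma -> cm_iso V W.
Proof.
move=> AB [fv [L0 L1 Ln] [Y0 Yn] Mn] [fw [L0' L1' Ln'] [Y0' Yn'] Mn'].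
apply: (cm_iso_generators (tsv_span AB) fv fw) => e [] -> n.
- case: n => [|[|n]]; [by exists ('X + beta%:P) | by exists alpha%:P |].
  by exists 0; rewrite scale0r.
- by case: n => [|n]; [exists gamma%:P | exists 0; rewrite scale0r].
- by exists 0; rewrite scale0r.
Qed.

(** * The algebras TSV(a, b) and TSV(c) and their rank one modules *)

Section Concrete.
Variable F : numFieldType.
Implicit Types a b c alpha beta gamma : F.

Lemma free_act_delta n m (P : 'I_n -> 'I_m -> 'rV[{poly {poly F}}]_m) i j f k l :
  P i j = f *: delta_mx 0 l ->
  free_act P (delta_mx 0 i) (delta_mx 0 j) k = f`_k *: delta_mx 0 l.
Proof.
move=> Pij; apply/rowP => t; rewrite [LHS]free_actE free_act_poly_basis Pij !mxE.
by case: (t == l); rewrite ?andbT ?andbF ?mulr1 ?mulr0 ?coef0.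
Qed.

Lemma coef_degree1 (f g : {poly F}) k : ((f%:P + g%:P * 'X) : {poly {poly F}})`_k =
  match k with 0%N => f | 1%N => g | _ => 0 end.
Proof.
by rewrite coefD coefCM coefX coefC; case: k => [|[|k]];
  rewrite /= ?mulr0 ?mulr1 ?addr0 ?add0r.
Qed.

Lemma row3_span (x : 'rV[{poly F}]_3) : exists f g h : {poly F},
  x = f *: delta_mx 0 genL + g *: delta_mx 0 genY + h *: delta_mx 0 genM.
Proof.
exists (x 0 genL), (x 0 genY), (x 0 genM); apply/rowP => t; rewrite !mxE.
by case: t => -[|[|[|//]]] i; rewrite /= ?mulr1 ?mulr0 ?addr0 ?add0r; congr (x _ _);
  apply: val_inj.
Qed.

Section Tables.
Variables (P : 'I_3 -> 'I_3 -> 'rV[{poly {poly F}}]_3).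
Hypotheses (skewP : skew_on_basis P) (jacP : jacobi_on_basis P P).
Local Notation A := (freeLieConformal skewP jacP).

Lemma free_primary i j p b :
  P i j = (('X + b%:P)%:P + p%:P%:P * 'X) *: delta_mx 0 j ->
  primary (A := A) (delta_mx 0 i) (delta_mx 0 j) p b.
Proof.
move=> Pij; split=> [||k]; rewrite /= (free_act_delta _ Pij) coef_degree1 //.
by rewrite scale0r.
Qed.

Lemma free_tsv_brackets p b q b' s :
  P genL genL = ('X%:P + 2%:P%:P * 'X) *: delta_mx 0 genL ->
  P genL genY = (('X + b%:P)%:P + p%:P%:P * 'X) *: delta_mx 0 genY ->
  P genL genM = (('X + b'%:P)%:P + q%:P%:P * 'X) *: delta_mx 0 genM ->
  P genY genY = (('X * s)%:P + (s *+ 2)%:P * 'X) *: delta_mx 0 genM ->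
  P genY genM = 0 -> P genM genM = 0 ->
  tsv_brackets (A := A) (delta_mx 0 genL) (delta_mx 0 genY) (delta_mx 0 genM) p b q b' s.
Proof.
move=> LL LY LM YY YM MM.
have zero i j k : P i j = 0 -> free_act P (delta_mx 0 i) (delta_mx 0 j) k = 0 :> 'rV_3.
  move=> P0; have Pij : P i j = 0 *: delta_mx 0 genM by rewrite scale0r.
  by rewrite (free_act_delta k Pij) coef0 scale0r.
have YYE k := free_act_delta k YY.
split=> [||||||k|k|k].
- exact: row3_span.
- by apply: free_primary; rewrite addr0.
- exact: free_primary.
- exact: free_primary.
- by rewrite /= YYE coef_degree1.
- by rewrite /= YYE coef_degree1.
- by rewrite /= YYE coef_degree1 scale0r.
- exact: zero.
- exact: zero.
Qed.

Lemma free_rank1_generator alpha beta gamma g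
    (jacQ : jacobi_on_basis P (rank1_table (M_L_poly alpha beta) g)) : g = gamma%:P%:P ->
  rank1_generator (A := A) (delta_mx 0 genL) (delta_mx 0 genY) (delta_mx 0 genM)
    (V := freeConformalModule skewP jacP jacQ) (delta_mx 0 0) alpha beta gamma.
Proof.
move=> gE.
have tabE (f h : {poly {poly F}}) i : rank1_table f h i 0 =
    (match nat_of_ord i with 0%N => f | 1%N => h | _ => 0 end) *: delta_mx 0 0.
  by apply/rowP => t; rewrite !mxE ord1 eqxx mulr1.
have LE k := free_act_delta k (tabE (M_L_poly alpha beta) g genL).
have YE k := free_act_delta k (tabE (M_L_poly alpha beta) g genY).
have ME k := free_act_delta k (tabE (M_L_poly alpha beta) g genM).
have lE k : (M_L_poly alpha beta)`_k =
    match k with 0%N => 'X + beta%:P | 1%N => alpha%:P | _ => 0 end.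
  by rewrite /M_L_poly addrAC -polyCD coef_degree1.
split.
- move=> u; exists (u 0 0); split.
    by apply/rowP => t; rewrite !mxE ord1 eqxx mulr1.
  by move=> f ->; rewrite mxE mxE !eqxx mulr1.
- split=> [||n]; first by rewrite /= LE lE.
    by rewrite /= LE lE.
  by rewrite /= LE lE scale0r.
- split=> [|n]; first by rewrite /= YE gE coefC.
  by rewrite /= YE gE coefC scale0r.
- by move=> n; rewrite /= ME coef0 scale0r.
Qed.

End Tables.

Lemma TSV_brackets a b : tsv_brackets (A := TSV a b)
  (delta_mx 0 genL) (delta_mx 0 genY) (delta_mx 0 genM) a b ((a - 1) *+ 2) (b *+ 2) 1.
Proof.
refine (free_tsv_brackets (TSV_skew a b) (TSV_jacobi a b) _ _ _ _ _ _);
  rewrite /TSV_table /skew_completion /=.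
- by congr (_ *: _); rewrite !polyC_natr mulr_natl.
- by congr (_ *: _); rewrite polyCD addrAC.
- by congr (_ *: _); rewrite [('X + _)%:P]polyCD addrAC.
- by congr (_ *: _); rewrite mulr1 polyC_natr mulr_natl.
- reflexivity.
- reflexivity.
Qed.

Lemma TSVc_brackets c : tsv_brackets (A := TSVc c)
  (delta_mx 0 genL) (delta_mx 0 genY) (delta_mx 0 genM)
  (3%:R / 2%:R) c 0 (c *+ 2) (- 'X - (c *+ 2)%:P).
Proof.
refine (free_tsv_brackets (TSVc_skew c) (TSVc_jacobi c) _ _ _ _ _ _);
  rewrite /TSVc_table /skew_completion /=.
- by congr (_ *: _); rewrite !polyC_natr mulr_natl.
- by congr (_ *: _); rewrite polyCD addrAC.
- by congr (_ *: _); rewrite [('X + _)%:P]polyCD polyC0 mul0r addr0.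
- congr (_ *: _); move: (c *+ 2) => c2.
  by rewrite (rmorphMn polyC) polyCM polyCB polyCN /=; ring.
- reflexivity.
- reflexivity.
Qed.

End Concrete.

Theorem theorem4p11 (R : realType) :
  (forall a b : R[i],
    (forall V : conformalModule (TSV a b),
      cm_finite V -> ~ cm_trivial V -> cm_irreducible V ->
      cm_free_rank1 V /\
      (a <> 1 \/ b <> 0 ->
        exists alpha beta : R[i],
          alpha <> 0 /\ cm_iso V (TSV_M a b alpha beta))))
  /\
  (forall V : conformalModule (TSV (1 : R[i]) 0),
    cm_finite V -> ~ cm_trivial V -> cm_irreducible V ->
    exists alpha beta gamma : R[i],
      (alpha <> 0 \/ gamma <> 0) /\ cm_iso V (TSV10_M alpha beta gamma))
  /\
  (forall c : R[i], forall V : conformalModule (TSVc c),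
    cm_finite V -> ~ cm_trivial V -> cm_irreducible V ->
    cm_free_rank1 V /\
    exists alpha beta : R[i],
      alpha <> 0 /\ cm_iso V (TSVc_M c alpha beta)).
Proof.
split; [|split].
- move=> a b V finV ntV irrV.
  have [v [alpha [beta [gamma [gen nz gP]]]]] :=
    rank1_generator_ex (TSV_brackets a b) (oner_neq0 _) finV ntV irrV.
  split; first by case: gen => fv _ _ _; exists v.
  move=> ab; have g0 : gamma = 0 by case: gP => // -[a1 b0]; case: ab.
  exists alpha, beta; split; first by case: nz; rewrite ?g0.
  apply: (rank1_generator_iso (TSV_brackets a b) gen).
  by apply: free_rank1_generator; rewrite g0 !polyC0.
- move=> V finV ntV irrV.
  have [v [alpha [beta [gamma [gen nz _]]]]] :=
    rank1_generator_ex (TSV_brackets 1 0) (oner_neq0 _) finV ntV irrV.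
  exists alpha, beta, gamma; split=> //.
  apply: (rank1_generator_iso (TSV_brackets 1 0) gen).
  exact: free_rank1_generator.
- move=> c V finV ntV irrV.
  have s0 : - 'X - (c *+ 2)%:P != 0 :> {poly R[i]}.
    by rewrite -opprD oppr_eq0 -size_poly_eq0 size_XaddC.
  have [v [alpha [beta [gamma [gen nz gP]]]]] :=
    rank1_generator_ex (TSVc_brackets c) s0 finV ntV irrV.
  split; first by case: gen => fv _ _ _; exists v.
  have g0 : gamma = 0.
    (* Here p = 3/2, and doubling p = 1 would give 3 = 2. *)
    case: gP => // -[/eqP]; rewrite -(inj_eq (mulIf (_ : 2%:R != 0 :> R[i]))) ?pnatr_eq0 //.
    by rewrite divfK ?pnatr_eq0 // mul1r eqr_nat.
  exists alpha, beta; split; first by case: nz; rewrite ?g0.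
  apply: (rank1_generator_iso (TSVc_brackets c) gen).
  by apply: free_rank1_generator; rewrite g0 !polyC0.
Qed.
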